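(* $r(\mathcal T_{k+1},\mathcal T_{m+1})\leq k+m+o(k+m)$ as $k+m\rightarrow\infty$. That is, for every $\varepsilon>0$ there is an $n_0\in\mathbb N$ such that for all positive integers $k,m$ with $k+m\geq n_0$ we have $r(\mathcal T_{k+1},\mathcal T_{m+1})\leq (1+\varepsilon)(k+m)$.
   Context: Graphs are finite and simple; subgraphs are not necessarily induced. For $i\in\mathbb N$, $\mathcal T_i$ denotes the class of all trees of order $i$ (i.e. with $i$ vertices). For two classes of graphs $\mathcal H,\mathcal H'$, the Ramsey number $r(\mathcal H,\mathcal H')$ is the minimum integer $n$ such that for every graph $G$ of order at least $n$, either each graph $H\in\mathcal H$ is a subgraph of $G$, or each graph $H'\in\mathcal H'$ is a subgraph of the complement $\bar G$ of $G$. *)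

(* Defs.v *)
From mathcomp Require Import all_boot all_order all_algebra.
From mathcomp Require Import reals.

Set Implicit Arguments.
Unset Strict Implicit.
Unset Printing Implicit Defensive.

Record sgraph := SGraph {
  vertex :> finType;
  adj : rel vertex;
  adj_sym : symmetric adj;
  adj_irrefl : irreflexive adj }.

Definition order_of (G : sgraph) : nat := #|G|.

Section Complement.
Variable G : sgraph.

Definition compl_adj : rel G := fun x y => (x != y) && ~~ adj x y.

Lemma compl_adj_sym : symmetric compl_adj.
Proof. by move=> x y; rewrite /compl_adj eq_sym adj_sym. Qed.

Lemma compl_adj_irrefl : irreflexive compl_adj.
Proof. by move=> x; rewrite /compl_adj eqxx. Qed.

Definition compl_graph : sgraph := SGraph compl_adj_sym compl_adj_irrefl.

End Complement.

(* Containment is up to isomorphism and not necessarily induced: [G] has a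
   (possibly non-spanning) subgraph isomorphic to [H]. *)
Definition subgraph_of (H G : sgraph) : Prop :=
  exists f : H -> G, injective f /\ {homo f : x y / adj x y}.

Definition connected (G : sgraph) : Prop :=
  0 < order_of G /\ forall x y : G, connect (@adj G) x y.

(* A graph cycle is a [ucycle] of length at least 3: a single edge [x y] gives
   a [ucycle] [:: x; y] of length 2, and [::] is a [ucycle] as well. *)
Definition acyclic (G : sgraph) : Prop :=
  forall c : seq G, 2 < size c -> ~ ucycle (@adj G) c.

Definition is_tree (G : sgraph) : Prop := connected G /\ acyclic G.

Definition graph_class := sgraph -> Prop.

Definition trees (i : nat) : graph_class :=
  fun G => is_tree G /\ order_of G = i.

Definition ramsey_property (C C' : graph_class) (n : nat) : Prop :=
  forall G : sgraph, n <= order_of G ->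
    (forall H : sgraph, C H -> subgraph_of H G) \/
    (forall H' : sgraph, C' H' -> subgraph_of H' (compl_graph G)).

(* [is_ramsey_number C C' r] reads "r(C, C') exists and equals r"; such an [r]
   is unique. *)
Definition is_ramsey_number (C C' : graph_class) (r : nat) : Prop :=
  ramsey_property C C' r /\
  forall n : nat, ramsey_property C C' n -> r <= n.

(* Main.v *)
(** Let red be the graph and blue its complement. By regularity, pass to a
    weighted graph on clusters of equal size in which almost every pair is
    regular; a pair is a red (blue) edge when its red (blue) density is not
    negligible.

    A tree can be embedded in one colour once there are an edge [A B] of the
    cluster graph and a half-integral matching such that [A] and [B] have degree
    slightly more than the order of the tree into the part covered by the
    matching. Boundedly many seeds cut the tree into tiny components, each
    adjacent to seeds of one parity only; the seeds go into [A] and [B], and the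
    components into the matched pairs, turned so that both sides of a pair fill
    up evenly as long as this matters.

    If neither colour has such a structure, take in each colour the set [I] of
    maximal deficiency and its neighbourhood [S]: every cluster outside [I] is
    fully covered, and [I] has no edges inside and to the clusters outside [S].
    Vertices of the red [I] thus have blue degree [t - |S|], so if [S] is small
    in both colours, the red [I] lies almost inside the blue [S] and conversely,
    both matchings are almost perfect, and the clusters of large red degree or
    those of large blue degree form a large monochromatic clique, which is
    absurd. If the red [S] is large, then the blue [I] lies almost inside it.
    Either the blue [I] contains a red edge, whose ends see almost everything
    outside the blue [S], or it is negligible, and then averaging over the red
    matching between [S] and [I] finds the edge [A B] between these sets. *)

Require Import Defs.
From Stdlib Require Import Classical.
From mathcomp Require Import all_boot all_order all_algebra.
From mathcomp Require Import reals.
From mathcomp Require Import zify ring lra.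
Import Order.TTheory GRing.Theory Num.Theory.

Set Implicit Arguments.
Unset Strict Implicit.
Unset Printing Implicit Defensive.

(** * Trees as parent arrays *)

(** The obstacle is that trees can be very unbalanced. A component may load one side of a matched
    pair far more than the other, and a seed sees only a fraction of each side, given by the
    density. Turning components against the imbalance makes the number of seen vertices on both
    sides the true capacity of a pair, so a seed can serve as much as its weighted degree into the
    covered clusters, whatever the bipartition of the tree. The clusters seen from A and from B may
    differ. Every half-cluster is therefore divided in advance into a portion for each parity of
    seeds, which makes the degree conditions at A and B independent of each other. Half-integrality
    replaces matchings of the cluster graph, which odd components obstruct, by matchings of a
    bipartite graph. There deficiency is the only obstruction, and the deficient set I and its
    neighbourhood S come with an optimal matching. All errors in the cluster graph are measured by
    one parameter rho, the bound on irregular partners; the comparison of the two colours consumes 8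
    rho. *)

Lemma connect_restrict_path (T : finType) (e : rel T) (P : pred T) (x : T) p :
  path (fun y z => [&& e y z, P y & P z]) x p -> path e x p /\ all P p.
Proof.
elim: p x => //= a p IH x /andP[/and3P[exa _ Pa] /IH[pp ap]].
by rewrite exa Pa pp.
Qed.

Lemma acyclic_unique_nbr (T : sgraph) (s : seq T) (v u u' : T) :
  acyclic T ->
  (forall x y, x \in s -> y \in s ->
     connect (fun y z => [&& adj y z, y \in s & z \in s]) x y) ->
  v \notin s -> u \in s -> u' \in s -> adj v u -> adj v u' -> u = u'.
Proof.
move=> acT con vs us us' avu avu'; apply/eqP/negP => /negP neq.
have /connectP[p0 pth0 lst0] := con _ _ us us'.
case/shortenP: pth0 lst0 => p pth up _ lst.
have [pe pin] := @connect_restrict_path T (@adj T) (mem s) u p pth.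
apply: (acT (v :: u :: p)).
  by case: p lst {pth up pe pin} => //= E; rewrite E eqxx in neq.
rewrite /ucycle /cycle rcons_path /= avu pe -lst adj_sym avu' /=.
have -> : (u \notin p) && uniq p by move: up.
rewrite andbT inE negb_or; apply/andP; split.
  by apply/eqP => E; rewrite E us in vs.
by apply/negP => /(allP pin) /=; apply/negP.
Qed.

Definition parent_array (N : nat) (par : nat -> nat) : Prop :=
  forall i, 0 < i < N -> par i < i.

(** A search order: connectivity supplies a vertex adjacent to the current list, and acyclicity
    makes its neighbour in the list unique. The last clause makes parent edges the only edges, so an
    embedding has only to respect these. *)
Lemma tree_prefix (T : sgraph) (x0 : T) m :
  is_tree T -> 0 < m <= #|T| ->
  exists (s : seq T) (par : nat -> nat),
    [/\ uniq s, size s = m, parent_array m par,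
      forall i, 0 < i < m -> adj (nth x0 s (par i)) (nth x0 s i)
    & forall i j, j < i < m -> adj (nth x0 s j) (nth x0 s i) -> j = par i].
Proof.
move=> [[_ conT] acT]; elim: m => // -[_ _|m IH lem].
  exists [:: x0], id; split=> //; try by move=> [|i].
  by move=> [|i] // j; rewrite ltnS andbC /=; case: j.
have [|s [par [us ss ppar apar upar]]] := IH; first by lia.
set e' := (fun y z => [&& adj y z, y \in s & z \in s]).
have symE : connect_sym e'.
  by apply: sym_connect_sym => x y; rewrite /e' adj_sym (andbC (x \in s)).
have con0 i : i < m.+1 -> connect e' (nth x0 s 0) (nth x0 s i).
  elim: i {-2}i (leqnn i) => [|k IHk] i; first by rewrite leqn0 => /eqP ->.
  move=> lik lim; have [->|i0] := posnP i; first exact: connect0.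
  have pi := ppar i; rewrite i0 lim in pi; have {}pi := pi isT.
  apply: connect_trans (IHk (par i) _ _) _; try by lia.
  by apply: connect1; rewrite /e' apar ?i0 //= !mem_nth ?ss //; lia.
have con x y : x \in s -> y \in s -> connect e' x y.
  move=> /(nthP x0)[i li <-] /(nthP x0)[j lj <-].
  rewrite ss in li lj; apply: connect_trans (con0 j lj).
  by rewrite symE con0.
have [v0 v0s] : exists v, v \notin s.
  apply/existsP; rewrite -negb_forall; apply/negP => /forallP al.
  have : #|T| <= #|s| by apply: subset_leq_card; apply/subsetP => x _; exact: al.
  by rewrite (card_uniqP us) ss; lia.
have hs0 : nth x0 s 0 \in s by rewrite mem_nth // ss.
have [v [u [vs us' auv]]] : exists v u, [/\ v \notin s, u \in s & adj u v].
  have /connectP[p pth lst] := conT (nth x0 s 0) v0.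
  elim: p (nth x0 s 0) hs0 pth lst => [|a p IHp] y ys /=.
    by move=> _ E; rewrite E ys in v0s.
  move=> /andP[aya pth] lst; have [ia|ia] := boolP (a \in s); last by exists a, y.
  exact: (IHp a).
have [iu liu eu] := nthP x0 us'.
exists (rcons s v), (fun i => if i == m.+1 then index u s else par i).
have nr i : i < m.+1 -> nth x0 (rcons s v) i = nth x0 s i.
  by move=> li; rewrite nth_rcons ss li.
have nv : nth x0 (rcons s v) m.+1 = v by rewrite nth_rcons ss ltnn eqxx.
have iul : index u s < m.+1 by rewrite -ss index_mem.
split.
- by rewrite rcons_uniq vs us.
- by rewrite size_rcons ss.
- move=> i /andP[i0 li]; case: eqP => [->|ni] //.
  by apply: ppar; lia.
- move=> i /andP[i0 li]; case: eqP => [->|ni].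
    by rewrite nv nr // nth_index.
  have li' : i < m.+1 by lia.
  have := ppar i; rewrite i0 li' => /(_ isT) pi.
  by rewrite !nr //; [apply: apar; rewrite i0|lia].
- move=> i j /andP[ji li]; case: eqP => [E|ni].
    rewrite E nv nr; last by lia.
    move=> ajv; have js : nth x0 s j \in s by rewrite mem_nth // ss; lia.
    have <- : nth x0 s j = u.
      by apply: (acyclic_unique_nbr acT con vs js us'); rewrite adj_sym.
    by rewrite index_uniq // ss; lia.
  by rewrite !nr; try lia; apply: upar; lia.
Qed.

Lemma subgraph_of_tree (T G : sgraph) :
  is_tree T ->
  (forall par, parent_array #|T| par ->
     exists f : nat -> G,
       {in gtn #|T| &, injective f} /\
       forall i, 0 < i < #|T| -> adj (f i) (f (par i))) ->
  subgraph_of T G.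
Proof.
move=> tT hf; have T0 : 0 < #|T| by case: tT => -[].
have /card_gt0P[x0 _] := T0.
have [|s [par [us ss ppar apar upar]]] := @tree_prefix T x0 #|T| tT.
  by rewrite T0 leqnn.
have [f [fi fa]] := hf par ppar.
have si x : x \in s.
  have /subset_cardP : #|s| = #|T| by rewrite (card_uniqP us).
  by move=> /(_ (subset_predT _)) ->.
have ixl x : index x s < #|T| by rewrite -ss index_mem.
exists (fun x => f (index x s)); split.
  move=> x y /fi; rewrite !inE !ixl => /(_ isT isT) E.
  by rewrite -(nth_index x0 (si x)) E nth_index.
move=> x y axy.
wlog lt : x y axy / index x s < index y s.
  move=> W; case: (ltngtP (index x s) (index y s)) => [||E].
  - exact: W.
  - by move=> /W; rewrite adj_sym => /(_ axy); rewrite adj_sym.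
  - have E' : x = y by rewrite -(nth_index x0 (si x)) E nth_index.
    by rewrite E' adj_irrefl in axy.
have E : index x s = par (index y s).
  by apply: upar; rewrite ?lt ?ixl // !nth_index.
by rewrite adj_sym E fa // ixl (leq_ltn_trans _ lt).
Qed.

(** * Cutting a tree into small components *)

Section ParentRecursion.
Variables (A : Type) (par : nat -> nat) (F : nat -> A -> A) (a : A).

(** Recursion along parents is not structural; the index itself is enough fuel, since every parent
    has a smaller index. *)
Fixpoint par_rec_fuel (k i : nat) : A :=
  if k is k'.+1 then
    if i == 0 then a else F i (par_rec_fuel k' (par i))
  else a.

Definition par_rec (i : nat) : A := par_rec_fuel i i.

Lemma par_rec0 : par_rec 0 = a.
Proof. by []. Qed.

Lemma par_recE N i : parent_array N par -> 0 < i < N ->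
  par_rec i = F i (par_rec (par i)).
Proof.
move=> parP.
have fuel k j : j <= k -> j < N -> par_rec_fuel k j = par_rec_fuel j j.
  elim: k {-2}k (leqnn k) j => [|K IH] [|k] // lk j.
  - by case: j.
  - by case: j.
  case: j => [|j] // ljk ljN; rewrite /=; congr F.
  have pj : par j.+1 < j.+1 by apply: parP; rewrite ljN.
  by rewrite IH ?[RHS]IH //; lia.
move=> iN; have pi := parP i iN; case: i iN pi => // i iN pi.
by rewrite /par_rec /=; congr F; apply: fuel; lia.
Qed.

End ParentRecursion.

Section Seeds.
Variables (par : nat -> nat).

Definition depth_parity : nat -> bool := par_rec par (fun _ b => ~~ b) false.

(** The closest member of [W] on the way from [i] to the root, [i] included, with the root [0] as
    default. *)
Definition near (W : pred nat) : nat -> nat :=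
  par_rec par (fun i r => if W i then i else r) 0.

(* The root of the component of the forest [T - W] containing [i]; a seed is
   its own [top]. *)
Definition top (W : pred nat) : nat -> nat :=
  par_rec par (fun i r => if W i || W (par i) then i else r) 0.

Variable N : nat.
Hypothesis parP : parent_array N par.

Lemma depth_parityS i : 0 < i < N ->
  depth_parity i = ~~ depth_parity (par i).
Proof. exact: par_recE. Qed.

Lemma nearE W i : 0 < i < N -> near W i = if W i then i else near W (par i).
Proof. exact: par_recE. Qed.

Lemma topE W i : 0 < i < N ->
  top W i = if W i || W (par i) then i else top W (par i).
Proof. exact: par_recE. Qed.

Lemma par_ind (P : nat -> Prop) :
  (0 < N -> P 0) -> (forall i, 0 < i < N -> P (par i) -> P i) ->
  forall i, i < N -> P i.
Proof.
move=> P0 PS i; elim/ltn_ind: i => i IH iN.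
have [->|i0] := posnP i; first by apply: P0; lia.
have := parP (i := i); rewrite i0 iN => /(_ isT) pi.
by apply: PS; rewrite ?i0 //; apply: IH => //; lia.
Qed.

Lemma near_le W i : i < N -> near W i <= i.
Proof.
move: i; apply: par_ind => // i iN IH; rewrite nearE //.
by have pi := parP iN; case: (W i) => //; lia.
Qed.

Lemma near_id (W : pred nat) i : i < N -> W i -> near W i = i.
Proof.
by have [->|i0] := posnP i => // iN wi; rewrite nearE ?i0 // wi.
Qed.

(** A vertex whose closest seed is [j] meets only indices above [j] on its way there. This makes the
    choice in [heavy_seeds] well founded. *)
Lemma near_agree (W W' : pred nat) j i : (forall x, j < x -> W x = W' x) ->
  i < N -> (near (predU1 j W) i == j) = (near (predU1 j W') i == j).
Proof.
move=> E; move: i.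
apply: (par_ind (P := fun i => (near (predU1 j W) i == j) = (near (predU1 j W') i == j))).
  by move=> _; rewrite /near !par_rec0.
move=> i iN IH; rewrite !(nearE _ iN) /=.
case: (ltngtP j i) => [ji|ij|ji].
- by rewrite /= E //; case: (W' i).
- have pi := parP iN; have pN : par i < N by lia.
  have small (V : pred nat) (b : bool) : (if b then i else near V (par i)) <= i.
    by have := near_le V pN; case: b; lia.
  by rewrite !ltn_eqF // (leq_ltn_trans (small _ _) ij).
- by rewrite /= ji eqxx.
Qed.

(** Indices are decided from the largest down: [j] becomes a seed when more than [beta] vertices
    would have it as their closest seed, which depends only on the seeds above [j]. *)
Lemma heavy_seeds (beta : nat) : exists W : pred nat,
  forall j, 0 < j < N ->
    W j = (beta < #|[set x : 'I_N | near (predU1 j W) x == j]|).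
Proof.
suff H d : exists W : pred nat, forall j, N - d <= j < N -> 0 < j ->
    W j = (beta < #|[set x : 'I_N | near (predU1 j W) x == j]|).
  have [W HW] := H N; exists W => j /andP[j0 jN].
  by apply: HW => //; lia.
elim: d => [|d [W HW]].
  by exists pred0 => j; lia.
have [dN|dN] := leqP N d.
  by exists W => j jN; apply: HW; lia.
pose j0 := N - d.+1.
pose W' : pred nat := fun j => if j == j0
  then beta < #|[set x : 'I_N | near (predU1 j0 W) x == j0]| else W j.
have agr j : j0 <= j -> #|[set x : 'I_N | near (predU1 j W') x == j]| =
    #|[set x : 'I_N | near (predU1 j W) x == j]|.
  move=> jj; apply: eq_card => x; rewrite !inE; apply: near_agree => // y jy.
  by rewrite /W'; case: eqP => //; lia.
exists W' => j jN jp; rewrite agr; last by rewrite /j0; lia.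
rewrite /W'; case: eqP => [->//|nj]; apply: HW => //.
by rewrite /j0 in nj; lia.
Qed.

Lemma top_near (W W' : pred nat) r i : {subset W <= W'} -> ~~ W' r -> i < N ->
  top W' i = r -> near (predU1 r W) i = r.
Proof.
move=> sub nr; move: i; apply: par_ind => [_ <-|i iN IH]; first by [].
rewrite topE // nearE //=; case: eqP => [->//|ni] /=.
case: ifP => [_ E|/norP[nWi nWp] /IH ->]; first by case: ni.
by case: ifP => // /(sub i); rewrite unfold_in (negPf nWi).
Qed.

(** Each heavy seed owns more than [beta] vertices, and no vertex has two closest seeds. *)
Lemma heavy_seeds_card (beta : nat) (W : pred nat) : 0 < beta ->
  (forall j, 0 < j < N ->
    W j = (beta < #|[set x : 'I_N | near (predU1 j W) x == j]|)) ->
  #|[set i : 'I_N | (0 < i) && W i]| <= N %/ beta.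
Proof.
move=> b0 HW; rewrite leq_divRL //.
pose fib (i : 'I_N) := [set x : 'I_N | near W x == i].
apply: (@leq_trans (\sum_(i : 'I_N | (0 < i) && W i) #|fib i|)).
  rewrite -sum1_card big_distrl /= big_mkcond [leqRHS]big_mkcond /=.
  apply: leq_sum => i _; rewrite inE; case: ifP => // /andP[i0 Wi]; rewrite mul1n.
  have iN : 0 < i < N by rewrite i0 /=.
  move: (Wi); rewrite HW // => /ltnW /leq_trans; apply.
  apply: subset_leq_card; apply/subsetP => x; rewrite !inE => /eqP E.
  apply/eqP; move: (ltn_ord x) E; move: (x : nat); apply: par_ind => // y yN IH.
  rewrite !(nearE _ yN) /=; case: eqP => [-> | _] /=; first by rewrite Wi.
  by case: ifP.
apply: (@leq_trans (\sum_(i : 'I_N) #|fib i|)).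
  by rewrite [leqRHS](bigID (fun i : 'I_N => (0 < i) && W i)) leq_addr.
rewrite /fib; under eq_bigr => i _ do rewrite -sum1_card big_mkcond /=.
rewrite exchange_big /= -[leqRHS]card_ord -sum1_card.
apply: leq_sum => x _; rewrite -big_mkcond /=.
have nxN : near W x < N by apply: leq_ltn_trans (near_le _ _) _.
rewrite (eq_bigl (pred1 (Ordinal nxN))) ?big_pred1_eq // => i.
by rewrite !inE -val_eqE /= eq_sym.
Qed.

(** The bound counts the root, the heavy seeds and at most one further cut per heavy seed.
    Components are small because the [top] class of a non-seed [r] lies among the vertices that
    would have had [r] as closest seed, and [r] was not heavy. The last clause confines the seeds
    around a component to one parity. *)
Lemma seeds_exist (beta : nat) : 0 < beta -> 0 < N ->
  exists W : pred nat,
  [/\ W 0,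
    #|[set i : 'I_N | W i]| <= (N %/ beta).+1.*2,
    forall r, r < N -> ~~ W r -> #|[set x : 'I_N | top W x == r]| <= beta
  & forall w, 0 < w < N -> W w -> ~~ W (par w) ->
      depth_parity w = depth_parity (near W (par w))].
Proof.
move=> b0 N0; have [W0 HW] := heavy_seeds beta.
pose W' : pred nat := predU1 0 W0.
pose bad w := depth_parity w != depth_parity (near W' (par w)).
(* Cutting at the parent of a lower seed of the wrong parity gives a new seed
   of the same parity as the seed above it. *)
pose W : pred nat := fun u => W' u ||
  [exists w : 'I_N, [&& 0 < w, W' w, par w == u & bad w]].
(* The extra seeds do not change the parity of the closest seed, so it can be tested with [W']. *)
have near_par x : x < N -> depth_parity (near W x) = depth_parity (near W' x).
  move: x; apply: par_ind => // x xN IH; rewrite !(nearE _ xN).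
  have [W'x|nW'x] := boolP (W' x); first by rewrite /W W'x.
  case: ifP => [|_]; last exact: IH.
  rewrite /W (negPf nW'x) /= => /existsP[w /and4P[w0 _ /eqP pw]].
  rewrite /bad depth_parityS ?w0 ?ltn_ord // pw nearE // (negPf nW'x).
  by case: (depth_parity x); case: (depth_parity (near _ _)).
exists W; split.
- by [].
- pose A := [set i : 'I_N | (0 < i) && W0 i].
  have cA : #|A| <= N %/ beta by apply: heavy_seeds_card.
  pose p (i : 'I_N) : 'I_N := insubd (Ordinal N0) (par i).
  apply: (@leq_trans #|(Ordinal N0 |: A) :|: (p @: A)|).
    apply: subset_leq_card; apply/subsetP => i; rewrite !inE /W.
    case/orP => [|/existsP[w /and4P[w0 W'w /eqP pw _]]].
      rewrite /W' /= -val_eqE /=; case: (posnP i) => [->//|i0] /=.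
      by move=> ->.
    apply/orP; right; apply/imsetP; exists w.
      by move: W'w; rewrite inE w0 /= /W' /= (gtn_eqF w0).
    apply: val_inj; rewrite /p val_insubd pw ltn_ord //.
  have [leU _] := leq_card_setU (Ordinal N0 |: A) (p @: A); move: leU.
  have := leq_imset_card p A; have := cardsU1 (Ordinal N0) A.
  by case: (_ \notin _); lia.
- move=> r rN nWr; have r0 : 0 < r by case: r nWr {rN}.
  have := HW r; rewrite r0 rN => /(_ isT).
  have -> : W0 r = false.
    by apply/negbTE; move: nWr; rewrite /W /W' /= !negb_or => /andP[/andP[]].
  move=> /esym /negbT; rewrite -leqNgt; apply: leq_trans.
  apply: subset_leq_card; apply/subsetP => x; rewrite !inE => /eqP E.
  apply/eqP; apply: (top_near _ nWr _ E) => //.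
  by move=> y; rewrite !unfold_in /W /W' /= => ->; rewrite orbT.
- move=> w wN Ww nWp.
  have [W'w|nW'w] := boolP (W' w).
    have pN : par w < N by have := parP wN; lia.
    rewrite near_par //; apply/eqP; apply: contraNT nWp => bw.
    rewrite /W; apply/orP; right; apply/existsP.
    have wN' : w < N by lia.
    by exists (Ordinal wN'); rewrite /= W'w eqxx /bad bw; case/andP: wN => ->.
  move: Ww; rewrite /W (negPf nW'w) /= => /existsP[w2 /and4P[w20 W'w2 /eqP pw2 b2]].
  have pN : par w < N by have := parP wN; lia.
  rewrite near_par //; move: b2; rewrite /bad.
  have w2N : 0 < w2 < N by rewrite w20 ltn_ord.
  rewrite depth_parityS // pw2 (nearE _ wN) (negPf nW'w).
  by case: (depth_parity w); case: (depth_parity (near _ _)).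
Qed.

End Seeds.

Section TopFacts.
Variables (par : nat -> nat) (N : nat) (W : pred nat).
Hypotheses (parP : parent_array N par) (W0 : W 0).
Notation top := (top par W).
Notation near := (near par W).
Notation col := (depth_parity par).

Lemma top_le i : i < N -> top i <= i.
Proof.
move: i; apply: (par_ind parP) => // i iN IH; rewrite (topE parP _ iN).
by have pi := parP iN; case: (_ || _) => //; lia.
Qed.

Lemma top_seed i : i < N -> W i -> top i = i.
Proof.
by have [->|i0] := posnP i => // iN Wi; rewrite (topE parP) ?i0 // Wi.
Qed.

Lemma top_top i : i < N -> top (top i) = top i.
Proof.
move: i; apply: (par_ind parP) => // i iN IH; rewrite (topE parP _ iN).
case: ifP => [E|_]; last exact: IH.
by rewrite (topE parP _ iN) E.
Qed.

Lemma top_par i : 0 < i < N -> top i <> i ->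
  [/\ top (par i) = top i, ~~ W i & ~~ W (par i)].
Proof.
by move=> iN; rewrite (topE parP _ iN); case: ifP => // /norP[].
Qed.

Lemma top_nonseed i : i < N -> ~~ W i ->
  [/\ ~~ W (top i), W (par (top i)), 0 < top i & near i = par (top i)].
Proof.
move: i; apply: (par_ind parP) => [_ /negP//|i iN IH nWi].
rewrite (topE parP _ iN) (nearE parP _ iN) (negPf nWi) /=.
have pi := parP iN.
case: ifP => [Wp|/negbT nWp]; last exact: IH.
by split=> //; [lia|rewrite (near_id parP) //; lia].
Qed.

Lemma top_eq_seed i j : i < N -> W j -> top i = j -> i = j.
Proof.
move=> iN Wj E; apply/eqP; apply: contraTT Wj => ne.
have [i0|i0] := posnP i; first by move: ne; rewrite -E i0 eqxx.
have [||_ nWi _] := @top_par i; first by rewrite i0.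
  by move=> E'; move: ne; rewrite -E E' eqxx.
by rewrite -E; have [] := top_nonseed iN nWi.
Qed.

End TopFacts.

Lemma pick_fresh (G : finType) (A U : {set G}) : #|U| < #|A| ->
  exists2 x, x \in A & x \notin U.
Proof.
move=> lt; apply/subsetPn; apply: contraTN lt => /subset_leq_card.
by rewrite leqNgt.
Qed.

(** Vertices are placed by increasing index, parents first. Fewer than [beta] of them are placed
    before the last one, so degree [beta] in both directions always leaves a fresh neighbour. *)
Lemma greedy_component (G : finType) (e : rel G) (N : nat) (par : nat -> nat)
    (K : pred nat) (j beta : nat) (X Y : {set G}) (x0 : G) (col : nat -> bool) :
  parent_array N par ->
  (forall i, K i -> i < N) ->
  (forall i, K i -> i <> j -> [/\ 0 < i, K (par i) & col i = ~~ col (par i)]) ->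
  #|[set i : 'I_N | K i]| <= beta ->
  (forall x, x \in X -> beta <= #|[set y in Y | e x y]|) ->
  (forall y, y \in Y -> beta <= #|[set x in X | e y x]|) ->
  x0 \in X ->
  exists f : nat -> G,
  [/\ {in K &, injective f}, f j = x0,
      forall i, K i -> i <> j -> e (f (par i)) (f i)
    & forall i, K i -> f i \in if col i == col j then X else Y].
Proof.
move=> parP KN Kpar Kb degX degY x0X.
have jle i : K i -> j <= i.
  move=> Ki; elim/ltn_ind: i Ki => i IH Ki; have [->//|ni] := eqVneq i j.
  have [i0 Kp _] := Kpar i Ki (elimN eqP ni).
  have pi : par i < i by apply: parP; rewrite i0 KN.
  by apply: leq_trans (IH _ pi Kp) (ltnW pi).
suff H m : exists f : nat -> G,
  [/\ {in [pred i | K i && (i < m)] &, injective f}, f j = x0,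
      forall i, K i -> i < m -> i <> j -> e (f (par i)) (f i)
    & forall i, K i -> i < m -> f i \in if col i == col j then X else Y].
  have [f [fi fj fe fc]] := H N; exists f; split=> //.
  - by move=> a b Ka Kb'; apply: fi; rewrite inE !unfold_in in Ka Kb' *; rewrite ?Ka ?Kb' /= KN.
  - by move=> i Ki; apply: fe => //; apply: KN.
  - by move=> i Ki; apply: fc => //; apply: KN.
elim: m => [|m [f [fi fj fe fc]]].
  by exists (fun=> x0); split=> // ? ?; rewrite inE andbF.
have [Km|nKm] := boolP (K m); last first.
  have lt i : K i -> i < m.+1 -> i < m.
    by rewrite ltnS leq_eqVlt => Ki /orP[/eqP E|//]; rewrite -E Ki in nKm.
  exists f; split=> //.
  - move=> a b; rewrite !inE => /andP[Ka la] /andP[Kb' lb].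
    by apply: fi; rewrite inE ?Ka ?Kb' /= lt.
  - by move=> i Ki li; apply: fe => //; apply: lt.
  - by move=> i Ki li; apply: fc => //; apply: lt.
pose U := [set f (i : 'I_N) | i in [set i : 'I_N | K i && (i < m)]].
have mN := KN m Km.
have Ult : #|U| < beta.
  apply: leq_ltn_trans (leq_imset_card _ _) _; apply: leq_trans Kb.
  apply: proper_card; apply/properP; split.
    by apply/subsetP => i; rewrite !inE => /andP[].
  by exists (Ordinal mN); rewrite !inE /= ?ltnn ?andbF.
have inU i : K i -> i < m -> f i \in U.
  move=> Ki im; have iN := KN i Ki.
  by apply/imsetP; exists (Ordinal iN); rewrite ?inE /= ?Ki.
have [z [zU zS ze]] : exists z, [/\ z \notin U,
    z \in if col m == col j then X else Y & m <> j -> e (f (par m)) z].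
  have [E|nE] := eqVneq m j.
    exists x0; split; last by rewrite E.
      apply/imsetP => -[i]; rewrite inE => /andP[Ki im] _.
      by have := jle i Ki; rewrite -E leqNgt im.
    by rewrite E eqxx.
  have [m0 Kp cp] := Kpar m Km (elimN eqP nE).
  have pm : par m < m by apply: parP; rewrite m0.
  have := fc _ Kp pm; rewrite cp.
  have [E|nEc] := eqVneq (col (par m)) (col j).
    move=> /degX d; have [z] := pick_fresh (leq_trans Ult d).
    rewrite inE => /andP[zY ez] zU; exists z; split=> //.
    by rewrite E; case: (col j).
  move=> /degY d; have [z] := pick_fresh (leq_trans Ult d).
  rewrite inE => /andP[zX ez] zU; exists z; split=> //.
  by move: nEc; case: (col (par m)); case: (col j).
have [Ejm|njm] := eqVneq j m.
- have only i : K i -> i < m.+1 -> i = j by move=> /jle; rewrite Ejm; lia.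
  exists (fun=> x0); split=> //.
  + by move=> a b; rewrite !inE => /andP[/only Ha /Ha ->] /andP[/only Hb /Hb ->].
  + by move=> i /only Hi /Hi.
  + by move=> i /only Hi /Hi ->; rewrite eqxx.
pose f' i := if i == m then z else f i.
exists f'; split.
- move=> a b; rewrite !inE /f' => /andP[Ka la] /andP[Kb' lb].
  have [->|na] := eqVneq a m; have [->|nb] := eqVneq b m => //.
  + by move=> E; case/negP: zU; rewrite E inU //; lia.
  + by move=> E; case/negP: zU; rewrite -E inU //; lia.
  + by apply: fi; rewrite inE ?Ka ?Kb' /=; lia.
- by rewrite /f' (negPf njm).
- move=> i Ki li nij; have [i0 Kp _] := Kpar i Ki nij.
  have pi : par i < i by apply: parP; rewrite i0 KN.
  have npm : par i == m = false by lia.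
  rewrite /f' npm; have [E|ne] := eqVneq i m.
    by rewrite E; apply: ze; rewrite -E.
  by apply: fe => //; lia.
- move=> i Ki li; rewrite /f'; have [->//|ne] := eqVneq i m.
  by apply: fc => //; lia.
Qed.

(** * Embedding a tree with few seeds *)

(** A seed sees [x0] and [x1] vertices in the two sides of size [p], of which [u0] and [u1] count
    the used vertices. Either the sides are filled evenly, or each holds at least about
    [x0 + x1 - p] vertices; with total use below [x0 + x1], neither side can then overflow. *)
Definition balanced (p g beta x0 x1 u0 u1 : nat) : Prop :=
  u0 <= u1 + beta /\ u1 <= u0 + beta \/
  x0 + x1 <= p + (g + beta) + u0 /\ x0 + x1 <= p + (g + beta) + u1.

Lemma sub_room a b u x g : a - u <= b -> x <= a -> u + g <= x -> g <= b.
Proof. lia. Qed.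

Lemma ltnS_eqVlt m n : (m < n.+1) = (m == n) || (m < n).
Proof. by rewrite ltnS leq_eqVlt. Qed.

Lemma choose_side (p g beta x0 x1 u0 u1 k0 k1 : nat) :
  0 < g -> x0 <= p -> x1 <= p -> k0 + k1 <= beta ->
  balanced p g beta x0 x1 u0 u1 -> u0 + u1 + (3 * g + beta) <= x0 + x1 ->
  [/\ 0 < x0, u0 + g <= x0, u1 + g <= p
    & balanced p g beta x0 x1 (u0 + k0) (u1 + k1)] \/
  [/\ 0 < x1, u1 + g <= x1, u0 + g <= p
    & balanced p g beta x0 x1 (u0 + k1) (u1 + k0)].
Proof.
rewrite /balanced => g0 xp0 xp1 kb inv un.
have [big|] := boolP ((x0 + x1 <= p + (g + beta) + u0) &&
                      (x0 + x1 <= p + (g + beta) + u1)).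
  move: big => /andP[b0 b1].
  have [s|s] := leqP (u0 + g) x0; [left|right]; split; try lia.
rewrite negb_and -!ltnNge => small.
have {inv small}[d0 d1 s0 s1] : [/\ u0 <= u1 + beta, u1 <= u0 + beta,
    p + g + u0 < x0 + x1 & p + g + u1 < x0 + x1].
  by case: inv => -[i0 i1]; case/orP: small => s; split; lia.
have [s|s] := leqP u0 u1; have [k|k] := leqP k0 k1;
  [right|left|left|right]; split; try lia; left; lia.
Qed.

Section Host.
Variables (G : finType) (e : rel G).
Hypothesis e_sym : symmetric e.

Variables (N : nat) (par : nat -> nat) (W : pred nat) (beta : nat).
Hypotheses (parP : parent_array N par) (W0 : W 0).
Notation top := (top par W).
Notation near := (near par W).
Notation col := (depth_parity par).

Hypothesis small_comp : forall r, r < N -> ~~ W r ->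
  #|[set i : 'I_N | top i == r]| <= beta.
Hypothesis seed_parity : forall w, 0 < w < N -> W w -> ~~ W (par w) ->
  col w = col (near (par w)).

(* [Z b] hosts the seeds of parity [b]; a component hanging below a seed of
   parity [b] is embedded into a pair [(P b i o, P b i (~~ o))], the vertices
   at odd distance from the seed going to [P b i o].  At most [x b i o]
   neighbours of a seed are guaranteed in [P b i o], and [x b i o = 0]
   forbids that orientation. *)
Variables (Z : bool -> {set G}) (J : finType) (P : bool -> J -> bool -> {set G}).
Variables (p : bool -> nat) (x : bool -> J -> bool -> nat).
Variables (c g h e0 : nat).

Hypothesis cardP : forall b i o, #|P b i o| = p b.
Hypothesis x_le : forall b i o, x b i o <= p b.
Hypothesis disjP : forall b i o b' i' o' v,
  v \in P b i o -> v \in P b' i' o' -> [/\ b = b', i = i' & o = o'].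
Hypothesis disjZP : forall b b' i o v, v \in Z b -> v \notin P b' i o.

Hypothesis Z_nonempty : 0 < #|Z false|.
Hypothesis seeds_card : #|[set i : 'I_N | W i]| <= c.
Hypothesis Z_deg : forall b v, v \in Z b -> c <= #|[set w in Z (~~ b) | e v w]|.
Hypothesis P_deg : forall b i o v, 0 < x b i o -> v \in P b i o ->
  c <= #|[set w in Z b | e v w]|.
Hypothesis P_reg : forall b i o (Y : {set G}),
  Y \subset P b i (~~ o) -> g <= #|Y| ->
  #|[set v in P b i o | #|[set w in Y | e v w]| < h]| <= e0.
Hypotheses (hE : e0 + beta <= h) (gE : e0 < g).

Definition typical (b : bool) (a : G) (i : J) : bool :=
  [forall o, x b i o <= #|[set w in P b i o | e a w]|].

(** As long as a non-seed below a seed of parity [b] is unplaced, some typical pair has used less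
    than its summand, so it has the room [3 * g + beta] that [choose_side] asks for. *)
Hypothesis capacity : forall b a, a \in Z b ->
  #|[set i : 'I_N | ~~ W i && (col (near i) == b)]| <=
  \sum_(i | typical b a i) (x b i false + x b i true - (3 * g + beta)).

Definition used (j : nat) (f : nat -> G) b i o : nat :=
  #|[set k : 'I_N | (top k < j) && (f k \in P b i o)]|.

(** The stage [j] counts tops: a component enters as a whole when its topmost vertex is reached, so
    its pair and orientation are chosen once. *)
Record partial_embedding (j : nat) (f : nat -> G) : Prop := PartialEmbedding {
  pe_inj : forall a b, a < N -> b < N -> top a < j -> top b < j ->
    f a = f b -> a = b;
  pe_edge : forall i, 0 < i < N -> top i < j -> e (f (par i)) (f i);
  pe_seed : forall i, i < N -> top i < j -> W i -> f i \in Z (col i);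
  pe_comp : forall i, i < N -> top i < j -> ~~ W i -> exists k o,
    0 < x (col (near i)) k o /\
    f i \in P (col (near i)) k (if col i == col (near i) then ~~ o else o);
  pe_bal : forall b i, balanced (p b) g beta (x b i false) (x b i true)
    (used j f b i false) (used j f b i true) }.

Lemma top_par_le i : 0 < i < N -> top (par i) <= top i.
Proof.
move=> iN; have pi := parP iN.
have pN : par i < N by lia.
have [E|/eqP ne] := eqVneq (top i) i.
  by rewrite E (leq_trans (top_le parP W0 pN)) // ltnW.
by have [->] := top_par parP iN ne.
Qed.

Definition image_below (j : nat) (f : nat -> G) : {set G} :=
  [set f (k : 'I_N) | k in [set k : 'I_N | top k < j]].

Lemma in_image_below j f i : i < N -> top i < j -> f i \in image_below j f.
Proof.
by move=> iN ti; apply/imsetP; exists (Ordinal iN); rewrite ?inE.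
Qed.

Lemma extend_partial j f f' : partial_embedding j f ->
  (forall a b, a < N -> b < N -> top a = j -> top b = j -> f' a = f' b -> a = b) ->
  (forall a, a < N -> top a = j -> f' a \notin image_below j f) ->
  (forall i, 0 < i < N -> top i = j ->
     e (if top (par i) == j then f' (par i) else f (par i)) (f' i)) ->
  (forall i, i < N -> top i = j -> W i -> f' i \in Z (col i)) ->
  (forall i, i < N -> top i = j -> ~~ W i -> exists k o,
    0 < x (col (near i)) k o /\
    f' i \in P (col (near i)) k (if col i == col (near i) then ~~ o else o)) ->
  (forall b i, let n o := #|[set k : 'I_N | (top k == j) && (f' k \in P b i o)]| in
    balanced (p b) g beta (x b i false) (x b i true)
      (used j f b i false + n false) (used j f b i true + n true)) ->
  partial_embedding j.+1 (fun i => if top i == j then f' i else f i).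
Proof.
move=> pf inj' fresh edge' seed' comp' bal'.
split.
- move=> a b aN bN; rewrite !ltnS_eqVlt.
  have [ta _|_ /= ta] := eqVneq (top a) j; have [tb _|_ /= tb] := eqVneq (top b) j.
  + exact: inj'.
  + by move=> E; case/negP: (fresh a aN ta); rewrite E in_image_below.
  + by move=> E; case/negP: (fresh b bN tb); rewrite -E in_image_below.
  + exact: (pe_inj pf).
- move=> i iN; rewrite ltnS_eqVlt.
  have [ta _|ne /= ta] := eqVneq (top i) j; first exact: edge'.
  have := top_par_le iN; have [->|_ _] := eqVneq; first by lia.
  exact: (pe_edge pf).
- move=> i iN; rewrite ltnS_eqVlt.
  have [ta _|ne /= ta] := eqVneq (top i) j; first exact: seed'.
  exact: (pe_seed pf).
- move=> i iN; rewrite ltnS_eqVlt.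
  have [ta _|ne /= ta] := eqVneq (top i) j; first exact: comp'.
  exact: (pe_comp pf).
- move=> b i; have := bal' b i; cbv zeta.
  have E o : used j.+1 (fun i => if top i == j then f' i else f i) b i o =
      used j f b i o + #|[set k : 'I_N | (top k == j) && (f' k \in P b i o)]|.
    rewrite /used -(cardsID [set k : 'I_N | top k == j]) addnC; congr (_ + _).
      apply: eq_card => k; rewrite !inE ltnS_eqVlt.
      by have [->|ne] := eqVneq (top k) j; rewrite ?ltnn ?andbF.
    apply: eq_card => k; rewrite !inE ltnS_eqVlt.
    by have [->|ne] := eqVneq (top k) j; rewrite ?ltnn ?andbF ?andbT.
  by rewrite -!E.
Qed.

(** Every vertex counted on the left is a placed non-seed below a seed of parity [b], counted once
    because the sets [P] are disjoint; [j] is such a non-seed not yet placed, whence the strict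
    inequality. *)
Lemma used_le j f b : j < N -> ~~ W j -> top j = j -> col (near j) = b ->
  partial_embedding j f ->
  \sum_i (used j f b i false + used j f b i true) <
  #|[set i : 'I_N | ~~ W i && (col (near i) == b)]|.
Proof.
move=> jN nWj tj cj pf.
pose F := [set i : 'I_N | ~~ W i && (col (near i) == b)].
have jF : Ordinal jN \in F by rewrite inE /= nWj cj eqxx.
rewrite -/F (cardsD1 (Ordinal jN)) jF add1n ltnS.
pose in_ (k : 'I_N) i o := (top k < j) && (f k \in P b i o).
have -> : \sum_i (used j f b i false + used j f b i true) =
    \sum_(k : 'I_N) \sum_i (in_ k i false + in_ k i true).
  rewrite exchange_big /=; apply: eq_bigr => i _; rewrite big_split /=.
  by rewrite /used -!sum1_card; congr (_ + _); rewrite big_mkcond /=;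
    apply: eq_bigr => k _; rewrite inE /in_; case: ifP.
rewrite -sum1_card [leqRHS]big_mkcond /=; apply: leq_sum => k _.
have out : \sum_i (in_ k i false + in_ k i true) <= 1.
  have [/existsP[i /existsP[o io]]|no] := boolP [exists i, exists o, in_ k i o].
    have uni i' o' : in_ k i' o' -> i' = i /\ o' = o.
      case/andP: io => _ ki /andP[_ ki'].
      by have [_ -> ->] := disjP ki' ki.
    rewrite (bigD1 i) //= big1 ?addn0 => [|i' ni].
      have := uni i false; have := uni i true.
      by case: (in_ k i false); case: (in_ k i true) => // /(_ isT)[_ E1] /(_ isT)[_ E2]; rewrite -E1 in E2.
    have := uni i' false; have := uni i' true; move: ni.
    by case: (in_ k i' false); case: (in_ k i' true) => // /eqP ni; do ?[by move=> _ /(_ isT)[]|by move=> /(_ isT)[]].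
  rewrite big1 // => i _; move: no; rewrite negb_exists => /forallP/(_ i).
  by rewrite negb_exists => /forallP H; rewrite (negPf (H false)) (negPf (H true)).
case: ifP => // kF; rewrite leqn0 sum_nat_eq0; apply/forallP => i; apply/implyP => _.
suff H o : in_ k i o = false by rewrite !H.
apply: contraFF kF => /andP[tk fk]; rewrite !inE.
have -> : k != Ordinal jN by rewrite -val_eqE /=; apply: contraTneq tk => ->; rewrite tj ltnn.
have [Wk|nWk] /= := boolP (W k).
  by have := disjZP b i o (pe_seed pf (ltn_ord k) tk Wk); rewrite fk.
have [i' [o' [_ fk']]] := pe_comp pf (ltn_ord k) tk nWk.
by have [-> _ _] := disjP fk fk'; rewrite eqxx.
Qed.

Lemma seed_step j f : j < N -> W j -> partial_embedding j f ->
  exists f', partial_embedding j.+1 f'.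
Proof.
move=> jN Wj pf.
pose U := [set f (k : 'I_N) | k in [set k : 'I_N | W k && (top k < j)]].
have tj : top j = j by apply: top_seed parP _ _ _.
have Uc : #|U| < c.
  apply: leq_ltn_trans (leq_imset_card _ _) _; apply: leq_trans seeds_card.
  apply: proper_card; apply/properP; split.
    by apply/subsetP => i; rewrite !inE => /andP[].
  by exists (Ordinal jN); rewrite !inE ?Wj //= tj ltnn.
have [z [zZ zU ze]] : exists z, [/\ z \in Z (col j), z \notin U
    & 0 < j -> e (f (par j)) z].
  have [j0|j0] := posnP j.
    have /card_gt0P[z zZ] := Z_nonempty; exists z; split=> //.
      by rewrite j0.
    by apply/imsetP => -[k]; rewrite inE j0 ltn0 andbF.
  have jN' : 0 < j < N by rewrite j0.
  have pj := parP jN'; have pN : par j < N by lia.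
  have tp : top (par j) < j by apply: leq_ltn_trans (top_le parP W0 pN) pj.
  have cj := depth_parityS parP jN'.
  have : c <= #|[set w in Z (col j) | e (f (par j)) w]|.
    have [Wp|nWp] := boolP (W (par j)).
      by rewrite cj; apply: Z_deg; apply: pe_seed pf _ pN tp Wp.
    have [k [o [x0 fP]]] := pe_comp pf pN tp nWp.
    (* By parity the parent lies at odd distance from the seed above its component, hence on the
       side that sees [Z (col j)]. *)
    have cn := seed_parity jN' Wj nWp; rewrite -cn in x0 fP.
    apply: P_deg x0 _; move: fP; rewrite cj.
    by case: (col (par j)).
  move=> /(leq_trans Uc) /pick_fresh[z]; rewrite inE => /andP[zZ ez] zU.
  by exists z.
have only i : i < N -> top i = j -> i = j.
  by move=> iN; apply: (top_eq_seed parP W0 iN Wj).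
exists (fun i => if top i == j then z else f i).
apply: (extend_partial pf (f' := fun=> z)).
- by move=> a b aN bN /only -> // /only ->.
- move=> a aN ta; apply/imsetP => -[k]; rewrite inE => tk E.
  have [Wk|nWk] := boolP (W k).
    by case/negP: zU; apply/imsetP; exists k; rewrite ?inE ?Wk.
  have [i [o [_ fP]]] := pe_comp pf (ltn_ord k) tk nWk.
  by move: zZ => /disjZP /negP; apply; rewrite E; exact: fP.
- move=> i iN ti; have ij : i = j by apply: only => //; lia.
  have pi := parP iN; have pN : par i < N by lia.
  have := top_le parP W0 pN; rewrite ij in pi iN *.
  case: eqP => [->|_ _]; first by lia.
  by apply: ze; lia.
- by move=> i iN /only ->.
- by move=> i iN /only -> //; rewrite Wj.
- move=> b i; cbv zeta.
  have E o : #|[set k : 'I_N | (top k == j) && (z \in P b i o)]| = 0.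
    by apply: eq_card0 => k; rewrite !inE (negPf (disjZP _ _ _ zZ)) andbF.
  by rewrite !E !addn0; apply: pe_bal.
Qed.

Lemma card_free_ge j f b i o (A : {set G}) : A \subset P b i o ->
  #|A| - used j f b i o <= #|A :\: image_below j f|.
Proof.
move=> AP; rewrite cardsD leq_sub2l //.
pose D := [set k : 'I_N | (top k < j) && (f k \in P b i o)].
apply: leq_trans (leq_imset_card (fun k : 'I_N => f k) (mem D)).
apply: subset_leq_card; apply/subsetP => v; rewrite !inE => /andP[vA /imsetP[k]].
rewrite inE => tk E; apply/imsetP; exists k => //.
by rewrite inE tk -E (subsetP AP).
Qed.

Lemma nbrs_in_good (A B : {set G}) (F : G -> nat) v :
  A \subset B -> #|[set w in B | F w < h]| <= e0 ->
  h <= #|[set w in A | e v w]| ->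
  beta <= #|[set w in [set w in A | h <= F w] | e v w]|.
Proof.
move=> AB bad hv; rewrite -(leq_add2r e0) addnC; apply: leq_trans hE _.
apply: leq_trans hv _; rewrite -(cardsID [set w | h <= F w]).
apply: leq_add.
  by apply: subset_leq_card; apply/subsetP => w; rewrite !inE => /andP[/andP[-> ->] ->].
apply: leq_trans bad; apply: subset_leq_card; apply/subsetP => w.
by rewrite !inE -ltnNge => /andP[-> /andP[/(subsetP AB) -> _]].
Qed.

(** Used vertices are removed from the chosen pair, then those with few neighbours in the opposite
    free part. By regularity the latter are at most [e0] on each side, so degrees stay at least
    [h - e0 >= beta], and since [e0 < g] a neighbour of the seed survives as root. *)
Lemma component_step j f : j < N -> ~~ W j -> top j = j ->
  partial_embedding j f -> exists f', partial_embedding j.+1 f'.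
Proof.
move=> jN nWj tj pf.
have [_ Wp j0 nj] := top_nonseed parP W0 jN nWj; rewrite tj in Wp j0 nj.
have jN' : 0 < j < N by rewrite j0.
have pj := parP jN'; have pN : par j < N by lia.
have tp : top (par j) < j by apply: leq_ltn_trans (top_le parP W0 pN) pj.
pose b := col (par j).
have cj : col j = ~~ b by exact: (depth_parityS parP jN').
have aZ : f (par j) \in Z b by apply: pe_seed pf _ pN tp Wp.
set a := f (par j) in aZ.
have nearK i : i < N -> top i = j -> ~~ W i /\ near i = par j.
  move=> iN ti; have nWi : ~~ W i.
    by apply: contraL nWj => Wi; rewrite -ti (top_seed parP iN Wi) Wi.
  by split=> //; have [_ _ _ ->] := top_nonseed parP W0 iN nWi; rewrite ti.
have [i typi room] : exists2 i, typical b a i &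
    used j f b i false + used j f b i true + (3 * g + beta) <=
    x b i false + x b i true.
  have := used_le jN nWj tj _ pf; move=> /(_ b); rewrite nj => /(_ erefl).
  move=> /leq_trans /(_ (capacity aZ)) lt.
  apply/exists_inP; move: lt; apply: contraLR; rewrite negb_exists_in -leqNgt.
  move=> /forall_inP full; rewrite [leqRHS](bigID (typical b a)) /=.
  apply: leq_trans (leq_addr _ _); apply: leq_sum => i /full.
  by rewrite -ltnNge leq_subLR [leqRHS]addnC => /ltnW.
pose K (k : nat) := (k < N) && (top k == j).
have Kj : K j by rewrite /K jN tj eqxx.
have Kc : #|[set k : 'I_N | K k]| <= beta.
  apply: leq_trans (small_comp jN nWj); apply: subset_leq_card.
  by apply/subsetP => k; rewrite !inE => /andP[].
have Kpar k : K k -> k <> j -> [/\ 0 < k, K (par k) & col k = ~~ col (par k)].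
  move=> /andP[kN /eqP tk] kj; have k0 : 0 < k.
    by case: k kN tk kj => // _; rewrite /= => <-.
  have kN' : 0 < k < N by rewrite k0.
  have pk := parP kN'; split=> //; last exact: (depth_parityS parP kN').
  have ne : top k <> k by rewrite tk => E; apply: kj.
  have [E _ _] := top_par parP kN' ne.
  by rewrite /K E tk eqxx andbT (ltn_trans pk kN).
pose k0 := #|[set k : 'I_N | K k && (col k == col j)]|.
pose k1 := #|[set k : 'I_N | K k && (col k != col j)]|.
have k01 : k0 + k1 <= beta.
  apply: leq_trans Kc; rewrite -(cardsID [set k : 'I_N | col k == col j]).
  by rewrite leq_add // subset_leq_card //; apply/subsetP => k; rewrite !inE;
    case/andP=> -> ->.
pose u := used j f b i.
have [o [x0 roomr roomc bal]] : exists o, [/\ 0 < x b i o, u o + g <= x b i o,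
    u (~~ o) + g <= p b
  & balanced (p b) g beta (x b i false) (x b i true)
      (u false + (if o then k1 else k0)) (u true + (if o then k0 else k1))].
  have g0 : 0 < g by apply: leq_ltn_trans gE.
  by have [] := choose_side g0 (x_le b i false) (x_le b i true) k01
    (pe_bal pf b i) room; move=> [? ? ? ?]; [exists false|exists true].
pose I := image_below j f.
pose C := P b i o :\: I; pose D := P b i (~~ o) :\: I.
pose NC := [set w in P b i o | e a w] :\: I.
have NCg : g <= #|NC|.
  have sub : [set w in P b i o | e a w] \subset P b i o.
    by apply/subsetP => w; rewrite inE => /andP[].
  have := card_free_ge j f sub; rewrite -/NC.
  by move=> /sub_room; apply; [exact: forallP typi o|exact: roomr].
have Cg : g <= #|C|.
  apply: leq_trans NCg _; apply: subset_leq_card; apply: setSD.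
  by apply/subsetP => w; rewrite inE => /andP[].
have Dg : g <= #|D|.
  have := @card_free_ge j f b i (~~ o) _ (subxx _).
  by rewrite -/D cardP => /sub_room; apply; [exact: leqnn|exact: roomc].
pose X := [set v in C | h <= #|[set w in D | e v w]|].
pose Y := [set v in D | h <= #|[set w in C | e v w]|].
have CP : C \subset P b i o by apply: subsetDl.
have DP : D \subset P b i (~~ o) by apply: subsetDl.
have badX := P_reg DP Dg.
have badY : #|[set v in P b i (~~ o) | #|[set w in C | e v w]| < h]| <= e0.
  by apply: P_reg Cg; rewrite negbK.
have degX v : v \in X -> beta <= #|[set w in Y | e v w]|.
  by rewrite inE => /andP[_]; apply: nbrs_in_good DP badY.
have degY v : v \in Y -> beta <= #|[set w in X | e v w]|.
  by rewrite inE => /andP[_]; apply: nbrs_in_good CP badX.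
have [z zX za] : exists2 z, z \in X & e a z.
  have [|z zN zb] := @pick_fresh _ NC [set v in P b i o | #|[set w in D | e v w]| < h].
    by apply: leq_ltn_trans badX _; apply: leq_trans NCg.
  move: zN zb; rewrite !inE => /andP[nI /andP[zP ez]]; rewrite zP -leqNgt /= => hz.
  by exists z; rewrite // !inE nI zP.
have KN k : K k -> k < N by case/andP.
have [f' [fi fj fe fc]] := greedy_component parP KN Kpar Kc degX degY zX.
have fcP k : K k -> f' k \in P b i (if col k == col j then o else ~~ o) /\ f' k \notin I.
  move=> Kk; have := fc k Kk; case: ifP => _; rewrite !inE;
    by move=> /andP[/andP[-> ->] _].
exists (fun k => if top k == j then f' k else f k).
apply: (extend_partial pf).
- move=> k l kN lN /eqP tk /eqP tl; apply: fi; rewrite unfold_in /K.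
    by rewrite kN tk.
  by rewrite lN tl.
- by move=> k kN /eqP tk; have [|//] := fcP k; rewrite /K kN tk.
- move=> k kN tk; have Kk : K k by case/andP: kN => _ kN; rewrite /K tk eqxx andbT.
  have [E|nE] := eqVneq k j.
    by rewrite E ltn_eqF // -/a fj.
  have [_ /andP[_ ->] _] := Kpar k Kk (elimN eqP nE).
  by apply: fe => //; apply/eqP.
- by move=> k kN tk; have [/negPf ->] := nearK k kN tk.
- move=> k kN tk _; have [_ ->] := nearK k kN tk; rewrite -/b.
  have Kk : K k by rewrite /K tk eqxx andbT.
  have [fP _] := fcP k Kk; exists i, o; split=> //.
  by move: fP; rewrite cj; case: (col k); case: (b).
- move=> b' i'; cbv zeta.
  have [/andP[/eqP Eb /eqP Ei]|ne] := boolP ((b' == b) && (i' == i)).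
    have E o' : #|[set k : 'I_N | (top k == j) && (f' k \in P b i o')]| =
        if o' == o then k0 else k1.
      rewrite /k0 /k1; case: eqP => [->|/eqP no]; apply: eq_card => k;
        rewrite !inE /K ltn_ord /=; case: eqP => //= tk;
        have [|fP _] := fcP k; rewrite ?/K ?ltn_ord ?tk ?eqxx //;
        case: eqP fP => /= E fP; rewrite ?fP //.
      + by apply/negP => fP'; have [_ _] := disjP fP fP'; case: (o).
      + by apply/negP => fP'; have [_ _] := disjP fP fP'; apply/eqP; rewrite eq_sym.
      + by rewrite -(_ : ~~ o = o') //; case: (o) no; case: (o').
    by rewrite Eb Ei !E; move: bal; rewrite /u; case: (o).
  have E o' : #|[set k : 'I_N | (top k == j) && (f' k \in P b' i' o')]| = 0.
    apply: eq_card0 => k; rewrite !inE; apply/negP => /andP[tk fk].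
    have [|fP _] := fcP k; first by rewrite /K tk ltn_ord.
    by have [Eb Ei _] := disjP fk fP; rewrite Eb Ei !eqxx in ne.
  by rewrite !E !addn0; apply: pe_bal.
Qed.

Lemma host_embedding : exists f : nat -> G,
  {in gtn N &, injective f} /\ forall i, 0 < i < N -> e (f i) (f (par i)).
Proof.
have [f pf] : exists f, partial_embedding N f.
  have /card_gt0P[z0 _] := Z_nonempty.
  suff H j : j <= N -> exists f, partial_embedding j f by exact: H.
  elim: j => [_|j IH jN].
    exists (fun=> z0); split=> //.
    move=> b i; left; suff E o : used 0 (fun=> z0) b i o = 0 by rewrite !E.
    by apply: eq_card0 => k; rewrite !inE.
  have [f pf] := IH (ltnW jN).
  have [Wj|nWj] := boolP (W j); first exact: seed_step pf.
  have [tj|tj] := eqVneq (top j) j; first exact: component_step pf.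
  (* The stage of an index that is not its own top adds no vertex. *)
  have none i : i < N -> top i < j.+1 -> top i < j.
    move=> iN; rewrite ltnS_eqVlt => /orP[/eqP E|//].
    by move: tj; rewrite -E (top_top W parP iN) E eqxx.
  exists f; split.
  - by move=> a b aN bN /none ta /none tb; apply: (pe_inj pf); auto.
  - by move=> i iN /none ti; apply: (pe_edge pf) => //; apply: ti; lia.
  - by move=> i iN /none ti; apply: (pe_seed pf); auto.
  - by move=> i iN /none ti; apply: (pe_comp pf); auto.
  - move=> b i; have := pe_bal pf b i.
    suff E o : used j.+1 f b i o = used j f b i o by rewrite !E.
    apply: eq_card => k; rewrite !inE; congr (_ && _).
    by apply/idP/idP => [/none ->|/ltnW].
exists f; split.
  by move=> a b; rewrite !inE => aN bN; apply: (pe_inj pf) => //;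
    apply: leq_ltn_trans (top_le parP W0 _) _.
move=> i iN; rewrite e_sym; apply: (pe_edge pf) => //.
have iN' : i < N by lia.
by apply: leq_ltn_trans (top_le parP W0 iN') iN'.
Qed.

End Host.

(** * Matchings *)

Section Hall.
Variables (A B : finType) (r : A -> B -> bool).

Definition nbrs (Y : {set B}) (X : {set A}) : {set B} :=
  [set y in Y | [exists x in X, r x y]].

Lemma nbrsP (Y : {set B}) (X : {set A}) y :
  reflect (y \in Y /\ exists2 x, x \in X & r x y) (y \in nbrs Y X).
Proof.
rewrite inE; apply: (iffP andP) => -[yY H]; split=> //; first exact/exists_inP.
exact/exists_inP.
Qed.

(** The induction of Halmos and Vaughan: split along a proper tight subset or, if there is none,
    match one point arbitrarily. [b0] is the value where nothing is prescribed. *)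
Lemma hall (X : {set A}) (Y : {set B}) (b0 : B) :
  (forall Z : {set A}, Z \subset X -> #|Z| <= #|nbrs Y Z|) ->
  exists f : A -> B, {in X &, injective f} /\
    forall x, x \in X -> f x \in Y /\ r x (f x).
Proof.
have [n] := ubnP #|X|; elim: n X Y => // n IH X Y; rewrite ltnS => Xn H.
have [->|[x0 x0X]] := set_0Vmem X.
  by exists (fun=> b0); split=> [a ?|a]; rewrite inE.
have [/existsP[Z /and4P[Z0 ZX tight ZneX]]|none] :=
    boolP [exists Z : {set A}, [&& Z != set0, Z \subset X,
      #|nbrs Y Z| <= #|Z| & Z != X]].
  (* A tight proper subset: match it inside its neighbourhood, and the rest
     outside. *)
  have ZpX : Z \proper X by rewrite properEneq ZneX.
  have cZ := proper_card ZpX.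
  have [f1 [f1i f1P]] : exists f : A -> B, {in Z &, injective f} /\
      forall x, x \in Z -> f x \in nbrs Y Z /\ r x (f x).
    apply: IH => [|V VZ]; first exact: leq_trans cZ Xn.
    apply: leq_trans (H V (subset_trans VZ ZX)) _.
    apply: subset_leq_card; apply/subsetP => y /nbrsP[yY [x xV rxy]].
    apply/nbrsP; split; last by exists x.
    by apply/nbrsP; split=> //; exists x => //; apply: (subsetP VZ).
  have [f2 [f2i f2P]] : exists f : A -> B, {in X :\: Z &, injective f} /\
      forall x, x \in X :\: Z -> f x \in Y :\: nbrs Y Z /\ r x (f x).
    apply: IH => [|V VXZ].
      apply: leq_trans Xn; rewrite cardsD (setIidPr ZX) ltn_subrL.
      by rewrite !card_gt0 Z0; apply/set0Pn; exists x0.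
    have VX : V \subset X by apply: subset_trans VXZ (subsetDl _ _).
    have := H (Z :|: V); rewrite subUset ZX VX => /(_ isT).
    have dis : [disjoint Z & V].
      rewrite disjoint_sym disjoints_subset; apply/subsetP => v /(subsetP VXZ).
      by rewrite !inE => /andP[].
    rewrite cardsU disjoint_setI0 // cards0 subn0 => le.
    have : #|nbrs Y (Z :|: V)| <= #|nbrs Y Z| + #|nbrs (Y :\: nbrs Y Z) V|.
      rewrite -(cardsID (nbrs Y Z)) leq_add //.
        by apply: subset_leq_card; apply: subsetIr.
      apply: subset_leq_card; apply/subsetP => y; rewrite inE => /andP[ny].
      move=> /nbrsP[yY [x]]; rewrite inE => /orP[xZ|xV] rxy.
        by case/negP: ny; apply/nbrsP; split=> //; exists x.
      by apply/nbrsP; rewrite inE ny yY; split=> //; exists x.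
    by lia.
  exists (fun x => if x \in Z then f1 x else f2 x); split.
    move=> x y xX yX /=; case: ifP => xZ; case: ifP => yZ.
    - exact: f1i.
    - have [f1Z _] := f1P x xZ; have [|+ _] := f2P y; first by rewrite inE yZ.
      by rewrite inE => /andP[/negP n2 _] E; case: n2; rewrite -E.
    - have [f1Z _] := f1P y yZ; have [|+ _] := f2P x; first by rewrite inE xZ.
      by rewrite inE => /andP[/negP n2 _] E; case: n2; rewrite E.
    - by apply: f2i; rewrite inE ?xZ ?yZ.
  move=> x xX; case: ifP => xZ.
    by have [/nbrsP[? _] ?] := f1P x xZ.
  by have [|] := f2P x; rewrite inE ?xZ // => /andP[_ ?].
have : 0 < #|nbrs Y [set x0]|.
  by apply: leq_trans (H [set x0] _); rewrite ?cards1 ?sub1set.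
rewrite card_gt0 => /set0Pn[y0 /nbrsP[y0Y [x /set1P -> r0]]].
(* Proper nonempty subsets have a neighbour to spare, so deleting [y0] keeps the condition for
   them. *)
have [f [fi fP]] : exists f : A -> B, {in X :\ x0 &, injective f} /\
    forall x, x \in X :\ x0 -> f x \in Y :\ y0 /\ r x (f x).
  apply: IH => [|V VX].
    by apply: leq_trans Xn; rewrite [in leqRHS](cardsD1 x0) x0X.
  have [->|V0] := eqVneq V set0; first by rewrite cards0.
  have VX' : V \subset X by apply: subset_trans VX (subsetDl _ _).
  have lt : #|V| < #|nbrs Y V|.
    rewrite ltnNge; apply: contra none => le; apply/existsP; exists V.
    rewrite V0 VX' le /=; apply: contraTneq VX => ->.
    by apply/subsetPn; exists x0; rewrite // !inE eqxx.
  have : #|nbrs Y V| <= #|nbrs (Y :\ y0) V| + 1.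
    rewrite -(cards1 y0) -(cardsID [set y0]) addnC leq_add //.
      apply: subset_leq_card; apply/subsetP => y; rewrite !inE.
      by move=> /andP[-> /andP[-> ->]].
    by apply: subset_leq_card; apply: subsetIr.
  by lia.
exists (fun x => if x == x0 then y0 else f x); split.
  move=> a b aX bX /=; have [->|na] := eqVneq a x0; have [->|nb] := eqVneq b x0 => //.
  - have [|+ _] := fP b; rewrite !inE ?nb // => /andP[/eqP n2 _] E.
    by case: n2.
  - have [|+ _] := fP a; rewrite !inE ?na // => /andP[/eqP n2 _] E.
    by case: n2.
  - by apply: fi; rewrite !inE ?na ?nb.
move=> a aX; have [->|na] := eqVneq a x0; first by [].
by have [|] := fP a; rewrite !inE ?na // => /andP[_ ?].
Qed.

End Hall.

Section HalfMatching.
Variables (T : finType) (E : rel T).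
Hypothesis E_sym : symmetric E.

Definition nbh (X : {set T}) : {set T} := [set y | [exists x in X, E x y]].

Lemma nbhP (X : {set T}) y :
  reflect (exists2 x, x \in X & E x y) (y \in nbh X).
Proof. by rewrite inE; apply: exists_inP. Qed.

(* Koenig's theorem for the bipartite double cover of [E]: every vertex [v] is
   split into two halves, and [(v, s v)] matches the first half of [v] with the
   second half of [s v]. *)
Lemma half_matching : exists (I D : {set T}) (s : T -> T),
  [/\ {in D &, injective s}, forall v, v \in D -> E v (s v),
      [disjoint I & nbh I], ~: D \subset I & ~: (s @: D) \subset I] /\
  (#|~: D| + #|nbh I| = #|I|) /\ (#|~: (s @: D)| + #|nbh I| = #|I|).
Proof.
have [t0|] := posnP #|T|.
  have e0 (A : {set T}) : A = set0 by apply/setP => v; have := card0_eq t0 v; rewrite inE.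
  exists set0, setT, id; split; [split=> //|].
  - by move=> v; have := card0_eq t0 v; rewrite inE.
  - by rewrite disjoints_subset sub0set.
  - by rewrite [~: _]e0 sub0set.
  - by rewrite [~: _]e0 sub0set.
  by rewrite [~: setT]e0 [nbh _]e0 [~: _]e0 cards0.
move=> /card_gt0P[t0 _].
pose def (X : {set T}) := #|X| - #|nbh X|.
have nbh0 : #|nbh set0| <= #|@set0 T|.
  rewrite cards0 leqn0 cards_eq0; apply/eqP/setP => y; rewrite !inE.
  by apply/exists_inP => -[x]; rewrite inE.
(* A set of maximal deficiency. Subtraction truncates, so the maximum is taken over the sets where
   it does not; the empty set is one. *)
have [X nX Xmax] : exists2 X, #|nbh X| <= #|X| & forall Z, def Z <= def X.
  exists [arg max_(X > set0 | #|nbh X| <= #|X|) def X].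
    by case: arg_maxnP.
  move=> Z; case: arg_maxnP => // Y nY Ymax.
  have [le|lt] := leqP #|nbh Z| #|Z|; first exact: Ymax.
  by rewrite /def (eqP (_ : #|Z| - #|nbh Z| == 0)) // subn_eq0 ltnW.
set d := def X in Xmax.
(* By symmetry, removing the overlap from [X] also removes it from the neighbourhood, so the
   deficiency is kept and [I] becomes independent. *)
pose I := X :\: nbh X.
have sub : nbh I \subset nbh X :\: X.
  apply/subsetP => y /nbhP[x]; rewrite inE => /andP[nx xX] exy.
  rewrite inE; apply/andP; split; last by apply/nbhP; exists x.
  by apply: contra nx => yX; apply/nbhP; exists y; rewrite // E_sym.
have Id : #|I| = #|nbh I| + d.
  have := subset_leq_card sub; have := Xmax I; rewrite /d /def /I !cardsD setIC.
  have := subset_leq_card (subsetIl (nbh X) X).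
  have := subset_leq_card (subsetIr (nbh X) X).
  by move: nX; lia.
(* Ore's deficiency version of Hall's theorem: [d] universal partners restore the condition and
   leave at most [d] vertices without a real partner. *)
pose r x (z : T + 'I_d) := if z is inl y then E x y else true.
have [f [fi fP]] : exists f : T -> T + 'I_d,
    {in setT &, injective f} /\
    forall x, x \in setT -> f x \in setT /\ r x (f x).
  apply: (hall (inl t0)).
  move=> Z _; have [->|Z0] := eqVneq Z set0; first by rewrite cards0.
  have /set0Pn[z0 z0Z] := Z0.
  pose A1 := [set (inl y : T + 'I_d) | y in nbh Z].
  pose A2 := [set (inr i : T + 'I_d) | i in setT].
  have c1 : #|A1| = #|nbh Z| by rewrite card_imset // => u v [].
  have c2 : #|A2| = d by rewrite card_imset ?cardsT ?card_ord // => u v [].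
  have dis : A1 :&: A2 = set0.
    apply/setP => v; rewrite !inE; apply/negP => /andP[/imsetP[y _ ->]].
    by case/imsetP.
  apply: (@leq_trans #|A1 :|: A2|).
    rewrite cardsU dis cards0 c1 c2; have := Xmax Z; rewrite /def; lia.
  apply: subset_leq_card; apply/subsetP => v; rewrite in_setU.
  case/orP => /imsetP[y yZ ->]; apply/nbrsP; split=> //.
    by have /nbhP[x xZ xy] := yZ; exists x.
  by exists z0.
pose s x := if f x is inl y then y else x.
pose D := [set x | if f x is inl _ then true else false].
have sE v : v \in D -> f v = inl (s v) by rewrite inE /s; case: (f v).
have si : {in D &, injective s}.
  move=> u v /sE Eu /sE Ev Es; apply: fi; rewrite ?inE //.
  by rewrite Eu Ev Es.
have sP v : v \in D -> E v (s v).
  by move=> /sE Ev; have [_] := fP v (in_setT v); rewrite Ev.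
have cDs : #|~: (s @: D)| = #|~: D|.
  by rewrite [#|~: D|]cardsCs [LHS]cardsCs !setCK card_in_imset.
have cD : #|~: D| <= d.
  have [d0|d0] := posnP d.
    rewrite [leqRHS]d0 leqn0 cards_eq0; apply/eqP/setP => v; rewrite !inE.
    by case: (f v) => // i; have := ltn_ord i; rewrite {2}d0.
  pose w (x : T) : 'I_d := if f x is inr i then i else Ordinal d0.
  rewrite -[leqRHS](card_ord d) -(card_in_imset (f := w)); first exact: max_card.
  move=> u v; rewrite !inE /w => nu nv Ew; apply: fi; rewrite ?inE //.
  by move: nu nv Ew; case: (f u) => // i; case: (f v) => // j _ _ ->.
have cID : #|I :&: D| <= #|nbh I|.
  rewrite -(card_in_imset (f := s)) => [|u v].
    apply: subset_leq_card; apply/subsetP => y /imsetP[x]; rewrite inE => /andP[xI xD ->].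
    by apply/nbhP; exists x => //; apply: sP.
  by rewrite !inE => /andP[_ uD] /andP[_ vD]; apply: si; rewrite inE.
have cIR : #|I :&: s @: D| <= #|nbh I|.
  apply: (@leq_trans #|[set x in D | s x \in I]|).
    apply: leq_trans (leq_imset_card s (mem [set x in D | s x \in I])).
    apply: subset_leq_card; apply/subsetP => y; rewrite inE => /andP[yI /imsetP[x xD Ey]].
    by apply/imsetP; exists x; rewrite // inE xD -Ey.
  apply: subset_leq_card; apply/subsetP => x; rewrite inE => /andP[xD sI].
  by apply/nbhP; exists (s x) => //; rewrite E_sym; apply: sP.
(* [I] exceeds [nbh I] by [d], so at least [d] of its elements lie outside [A]; as at most [d]
   vertices do, these are all of them. *)
have out (A : {set T}) : #|~: A| <= d -> #|I :&: A| <= #|nbh I| ->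
    ~: A \subset I /\ #|~: A| = d.
  move=> cA cIA; have cI := cardsID A I.
  have subA : I :\: A \subset ~: A by apply/subsetP => v; rewrite !inE => /andP[].
  have le := subset_leq_card subA.
  have cE : #|I :\: A| == #|~: A| by apply/eqP; lia.
  have := subset_cardP (eqP cE); rewrite subA => /(_ isT) EA; split; last by lia.
  by apply/subsetP => v; rewrite -EA inE => /andP[].
have [oD1 oD2] := out D cD cID.
have [oR1 oR2] := out (s @: D) (leq_trans (eq_leq cDs) cD) cIR.
exists I, D, s; split; last by lia.
split=> //; rewrite disjoints_subset; apply/subsetP => v vI; rewrite inE.
by apply/negP => /(subsetP sub); rewrite inE => /andP[/negP]; case/setDP: vI.
Qed.

End HalfMatching.

Local Open Scope ring_scope.

(** * The reduced graph *)

(* The number of halves of [v] covered by a half-matching [s] with domain [D].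
   A fully covered cluster counts twice, hence the factor 2 below. *)
Definition half_cover (T : finType) (D : {set T}) (s : T -> T) (v : T) : nat :=
  (v \in D) + (v \in s @: D).

Definition wdeg (R : realFieldType) (T : finType) (E : rel T) (w : T -> T -> R)
    (f : T -> R) (u : T) : R :=
  \sum_(v | E u v) w u v * f v.

Definition seeded_matching (R : realFieldType) (T : finType) (E : rel T)
    (w : T -> T -> R) (kk : R) : Prop :=
  exists (D : {set T}) (s : T -> T) (A B : T),
    [/\ {in D &, injective s}, forall v, v \in D -> E v (s v), E A B
      & forall z, z \in [:: A; B] ->
          2 * kk <= wdeg E w (fun v => (half_cover D s v)%:R) z].

Section Reduced.
Variables (R : realFieldType) (T : finType) (reg : rel T).
Variables (w : bool -> T -> T -> R) (delta rho : R) (kk : bool -> R).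
Notation t := (#|T|%:R : R).

Hypothesis reg_sym : symmetric reg.
Hypothesis irreg : forall u, #|[set v | ~~ reg u v]|%:R <= rho.
Hypothesis w_sym : forall c u v, w c u v = w c v u.
Hypothesis w_ge0 : forall c u v, 0 <= w c u v.
Hypothesis w_compl : forall c u v, reg u v -> w c u v + w (~~ c) u v = 1.
Hypotheses (delta_gt0 : 0 < delta) (delta_le : delta <= 1 / 2).
Hypothesis delta_rho : delta * t <= rho.
Hypothesis kk_gt0 : forall c, 0 < kk c.
Hypothesis kk_sum : kk false + kk true + 8 * rho <= t.

Definition edge c : rel T := fun u v => reg u v && (delta <= w c u v).

Lemma edge_sym c : symmetric (edge c).
Proof. by move=> u v; rewrite /edge reg_sym w_sym. Qed.

Lemma rho_ge0 : 0 <= rho.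
Proof.
apply: le_trans delta_rho; apply: mulr_ge0; first exact: ltW.
exact: ler0n.
Qed.

Lemma w_le1 c u v : edge c u v -> w c u v <= 1.
Proof.
move=> /andP[ruv _]; have := w_compl c ruv; have := w_ge0 (~~ c) u v; lra.
Qed.

Lemma edge_or c u v : reg u v -> ~~ edge c u v ->
  edge (~~ c) u v /\ 1 - delta <= w (~~ c) u v.
Proof.
move=> ruv; rewrite /edge ruv /= -ltNge => lt.
have := w_compl c ruv; split; move: delta_le; lra.
Qed.

(* A regular pair that is not an edge of colour [c] has weight at least
   [1 - delta] in the other colour. *)
Lemma wdeg_ge c u (Z : {set T}) (f : T -> R) (M : R) :
  (forall v, 0 <= f v <= M) -> (forall v, v \in Z -> ~~ edge c u v) ->
  \sum_(v in Z) f v - 2 * M * rho <= wdeg (edge (~~ c)) (w (~~ c)) f u.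
Proof.
move=> fM noc; have f0 v : 0 <= f v by have /andP[] := fM v.
have fm v : f v <= M by have /andP[] := fM v.
have M0 : 0 <= M by apply: le_trans (f0 u) (fm u).
rewrite lerBlDr.
have step v : v \in Z -> f v <= (if edge (~~ c) u v then w (~~ c) u v * f v else 0)
     + M * (~~ reg u v)%:R + delta * M.
  move=> vZ; have dM : 0 <= delta * M by apply: mulr_ge0; rewrite // ltW.
  have [ruv|nruv] := boolP (reg u v).
    have [-> hw] := edge_or ruv (noc v vZ).
    rewrite mulr0 addr0; have : delta * f v <= delta * M by rewrite ler_pM2l.
    have : (1 - delta) * f v <= w (~~ c) u v * f v by rewrite ler_wpM2r.
    lra.
  rewrite mulr1; have : 0 <= (if edge (~~ c) u v then w (~~ c) u v * f v else 0).
    by case: ifP => // _; apply: mulr_ge0.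
  by have := fm v; lra.
apply: le_trans (ler_sum _ step) _.
rewrite !big_split /= -addrA; apply: lerD.
  rewrite /wdeg [leRHS]big_mkcond [leLHS]big_mkcond /=; apply: ler_sum => v _.
  by case: ifP => // _; case: ifP => // _; apply: mulr_ge0.
have -> : 2 * M * rho = M * rho + M * rho by lra.
apply: lerD.
  rewrite -mulr_sumr; apply: ler_wpM2l => //; apply: le_trans (irreg u).
  rewrite -sum1_card natr_sum [leLHS]big_mkcond [leRHS]big_mkcond /=.
  by apply: ler_sum => v _; rewrite inE; case: ifP => // _; case: (reg u v).
rewrite sumr_const -mulr_natr; have cZ : #|Z|%:R <= t by rewrite ler_nat max_card.
have : M * (delta * #|Z|%:R) <= M * rho.
  apply: ler_wpM2l => //; apply: le_trans delta_rho.
  by rewrite ler_pM2l.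
by lra.
Qed.

Notation deg c := (wdeg (edge c) (w c) (fun=> 1)).

(** The two weights of a regular pair add up to 1. Irregular pairs cost at most [rho], and dropping
    weights below [delta] costs at most [delta * t <= rho]. *)
Lemma deg_sum u : t - 2 * rho <= deg false u + deg true u.
Proof.
have reg1 v : reg u v -> 1 - delta <=
    (if edge false u v then w false u v * 1 else 0) +
    (if edge true u v then w true u v * 1 else 0).
  move=> ruv; have := w_compl false ruv; rewrite !mulr1 /=.
  have := edge_or (c := false) ruv; have := edge_or (c := true) ruv => /=.
  have := w_ge0 false u v; have := w_ge0 true u v.
  case: (boolP (edge false u v)) => e1; case: (boolP (edge true u v)) => e2 /=.
  - by move: delta_gt0; lra.
  - by move=> _ _ /(_ isT)[_ ?]; lra.
  - by move=> _ _ _ /(_ isT)[_ ?]; lra.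
  - by move=> _ _ /(_ isT)[].
rewrite /wdeg !(big_mkcond (edge _ u)) -big_split /= lerBlDr.
have -> : t = \sum_(v : T) 1 by rewrite sumr_const.
have step v : 1 <= (if edge false u v then w false u v * 1 else 0) +
    (if edge true u v then w true u v * 1 else 0) + ((~~ reg u v)%:R + delta).
  have [ruv|nruv] /= := boolP (reg u v); first by rewrite mulr0n add0r -lerBlDr; apply: reg1.
  by rewrite /edge (negPf nruv) /=; move: delta_gt0; lra.
apply: le_trans (ler_sum _ (fun v _ => step v)) _.
rewrite big_split /= lerD2l big_split /= sumr_const -mulr_natr.
have : \sum_(v : T) (~~ reg u v)%:R <= rho.
  apply: le_trans (irreg u); rewrite -sum1_card natr_sum [leRHS]big_mkcond /=.
  by apply: ler_sum => v _; rewrite inE; case: (reg u v).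
by move: delta_rho; lra.
Qed.

(** A regular pair is an edge in some colour, so the set lies among the irregular partners of any of
    its members. *)
Lemma no_edges_small (Z : {set T}) c :
  (forall u v, u \in Z -> v \in Z -> ~~ edge c u v) ->
  (forall u v, u \in Z -> v \in Z -> ~~ edge (~~ c) u v) ->
  #|Z|%:R <= rho.
Proof.
move=> n1 n2; have [->|[u uZ]] := set_0Vmem Z; first by rewrite cards0 rho_ge0.
apply: le_trans (irreg u); rewrite ler_nat; apply: subset_leq_card.
apply/subsetP => v vZ; rewrite inE; apply/negP => ruv.
by have [e _] := edge_or ruv (n1 u v uZ vZ); have := n2 u v uZ vZ; rewrite e.
Qed.

Definition decomposition c (I D : {set T}) (s : T -> T) : Prop :=
  [/\ {in D &, injective s}, forall v, v \in D -> edge c v (s v),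
      [disjoint I & nbh (edge c) I], ~: D \subset I & ~: (s @: D) \subset I] /\
  (#|~: D| + #|nbh (edge c) I| = #|I|)%N /\
  (#|~: (s @: D)| + #|nbh (edge c) I| = #|I|)%N.

Lemma natr_congr (m n : nat) : m = n -> m%:R = n%:R :> R.
Proof. by move->. Qed.

Lemma half_cover_le2 (D : {set T}) s v : 0 <= ((half_cover D s v)%:R : R) <= 2.
Proof. by rewrite ler0n ler_nat /half_cover; do 2!case: (_ \in _). Qed.

Section Decomposition.
Variables (c : bool) (I D : {set T}) (s : T -> T).
Hypothesis dec : decomposition c I D s.
Notation S := (nbh (edge c) I).
Notation cov := (fun v => (half_cover D s v)%:R : R).

Lemma half_cover_full v : v \notin I -> half_cover D s v = 2.
Proof.
have [[_ _ _ /subsetP iD /subsetP iR] _] := dec.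
move=> nI; have vD : v \in D.
  by apply: contraNT nI => nD; apply: iD; rewrite inE.
have vR : v \in s @: D by apply: contraNT nI => nD; apply: iR; rewrite inE.
by rewrite /half_cover vD vR.
Qed.

Lemma independent u v : u \in I -> v \in I -> ~~ edge c u v.
Proof.
have [[_ _ dis _ _] _] := dec; move=> uI vI; apply/negP => euv.
have : v \in S by apply/nbhP; exists u.
by rewrite (disjointFr dis vI).
Qed.

Lemma no_edge_out u v : u \in I -> v \notin S -> ~~ edge c u v.
Proof. by move=> uI vS; apply: contra vS => euv; apply/nbhP; exists u. Qed.

Lemma card_S_le : (#|S| <= #|I|)%N.
Proof. by have [_ [<- _]] := dec; apply: leq_addl. Qed.

Lemma card_SI : (#|S| + #|I| <= #|T|)%N.
Proof.
have [[_ _ dis _ _] _] := dec; rewrite -(cardsC I) addnC leq_add2l.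
by apply: subset_leq_card; rewrite -disjoints_subset disjoint_sym.
Qed.

Lemma cov_sum : \sum_v cov v = 2 * t - 2 * (#|I|%:R - #|S|%:R).
Proof.
have [_ [eD eR]] := dec.
have -> : \sum_v cov v = #|D|%:R + #|s @: D|%:R.
  rewrite -natr_sum /half_cover big_split /= natrD -!sum1_card.
  by congr (_%:R + _%:R); rewrite [RHS]big_mkcond; apply: eq_bigr => v _;
    case: (_ \in _).
have /natr_congr := cardsC D; have /natr_congr := cardsC (s @: D).
by move/natr_congr: eD; move/natr_congr: eR; rewrite !natrD; lra.
Qed.

(** Outside [S] no neighbour lies in [I], so all neighbours are fully covered. *)
Lemma wdeg_cov u : u \notin S -> wdeg (edge c) (w c) cov u = 2 * deg c u.
Proof.
move=> uS; rewrite /wdeg mulr_sumr; apply: eq_bigr => v euv.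
rewrite half_cover_full ?mulr1 1?mulrC //; apply: contra uS => vI.
by apply/nbhP; exists v; rewrite // edge_sym.
Qed.

(** The cover falls short of 2 by [2 * (#|I| - #|S|)] in total, and no edge weighs more than 1. *)
Lemma wdeg_cov_ge u :
  2 * deg c u - 2 * (#|I|%:R - #|S|%:R) <= wdeg (edge c) (w c) cov u.
Proof.
have -> : 2 * (#|I|%:R - #|S|%:R) = \sum_v (2 - cov v) :> R.
  by rewrite sumrB cov_sum sumr_const -mulr_natr; lra.
rewrite lerBlDr /wdeg mulr_sumr big_mkcond [X in _ <= X + _]big_mkcond.
rewrite -big_split /=; apply: ler_sum => v _.
have /andP[c0 c2] := half_cover_le2 D s v.
case: ifP => [euv|_]; last lra.
have w1 := w_le1 euv; have w0 := w_ge0 c u v.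
by have : 0 <= (1 - w c u v) * (2 - cov v); [apply: mulr_ge0; lra|nra].
Qed.

Lemma seeded_of A B : edge c A B ->
  2 * kk c <= wdeg (edge c) (w c) cov A -> 2 * kk c <= wdeg (edge c) (w c) cov B ->
  seeded_matching (edge c) (w c) (kk c).
Proof.
have [[si sP _ _ _] _] := dec; move=> eAB hA hB.
by exists D, s, A, B; split=> // z; rewrite !inE => /orP[] /eqP ->.
Qed.

Lemma outside_seeded A B : edge c A B -> A \notin S -> B \notin S ->
  kk c <= deg c A -> kk c <= deg c B ->
  seeded_matching (edge c) (w c) (kk c).
Proof.
move=> eAB AS BS hA hB; apply: (seeded_of eAB); rewrite wdeg_cov //; lra.
Qed.

Lemma deficient_seeded A B : edge c A B ->
  kk c + (#|I|%:R - #|S|%:R) <= deg c A -> kk c + (#|I|%:R - #|S|%:R) <= deg c B ->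
  seeded_matching (edge c) (w c) (kk c).
Proof.
move=> eAB hA hB; apply: (seeded_of eAB).
  by have := wdeg_cov_ge A; lra.
by have := wdeg_cov_ge B; lra.
Qed.

End Decomposition.

Lemma deg_other c u (Z : {set T}) : (forall v, v \in Z -> ~~ edge c u v) ->
  #|Z|%:R - 2 * rho <= deg (~~ c) u.
Proof.
move=> noc; have := @wdeg_ge c u Z (fun=> 1) 1 _ noc.
by rewrite sumr_const mulr1; apply => v; rewrite ler01 lexx.
Qed.

Notation good c := (seeded_matching (edge c) (w c) (kk c)).

Section BothColours.
Variables (I D : bool -> {set T}) (s : bool -> T -> T).
Hypothesis dec : forall c, decomposition c (I c) (D c) (s c).
Notation S c := (nbh (edge c) (I c)).

Lemma kk_sumc c : kk c + kk (~~ c) + 8 * rho <= t.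
Proof. by have := kk_sum; case: c => /=; lra. Qed.

Lemma deg_in_I c u : u \in I c -> t - #|S c|%:R - 2 * rho <= deg (~~ c) u.
Proof.
move=> uI; have := @deg_other c u (~: S c) _.
have /natr_congr := cardsC (S c); rewrite natrD => E H.
by apply: le_trans (H _); [lra|move=> v; rewrite inE; apply: no_edge_out uI].
Qed.

(** Members of [I c] have large degree in the other colour, into the complement of [S c]. An edge of
    that colour between two of them outside [S (~~ c)] would be a seed pair; having no edge of
    colour [c] either, they are few. *)
Lemma I_sub_S c : ~ good (~~ c) -> #|S c|%:R <= t - kk (~~ c) - 2 * rho ->
  #|I c :\: S (~~ c)|%:R <= rho.
Proof.
move=> ng hS; apply: (@no_edges_small _ c) => u v.
  by rewrite !inE => /andP[_ uI] /andP[_ vI]; apply: (independent (dec c)).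
move=> /setDP[uI uS] /setDP[vI vS]; apply/negP => euv; apply: ng.
by apply: (outside_seeded (dec (~~ c)) euv uS vS); [have := deg_in_I uI|have := deg_in_I vI]; lra.
Qed.

Lemma card_sub (A B : {set T}) : #|A|%:R <= #|A :\: B|%:R + #|B|%:R :> R.
Proof.
rewrite -natrD ler_nat -(cardsID B A) addnC leq_add2l.
by apply: subset_leq_card; apply: subsetIr.
Qed.


Hypothesis bad : forall c, ~ good c.

Lemma large_S : exists c, t - kk (~~ c) - 2 * rho < #|S c|%:R.
Proof.
have [/existsP[c hc]|none] := boolP [exists c, t - kk (~~ c) - 2 * rho < #|S c|%:R].
  by exists c.
have hS c : #|S c|%:R <= t - kk (~~ c) - 2 * rho.
  by move: none; rewrite negb_exists => /forallP /(_ c); rewrite -leNgt.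
exfalso.
have IS c : #|I c|%:R <= #|S (~~ c)|%:R + rho.
  by have := card_sub (I c) (S (~~ c)); have := I_sub_S (@bad _) (hS c); lra.
have SI c : #|S c|%:R <= #|I c|%:R :> R by rewrite ler_nat (card_S_le (dec c)).
(* A round trip: [I c] is almost inside [S (~~ c)], which is no larger than [I (~~ c)], which is
   almost inside [S c]. *)
have def c : #|I c|%:R - #|S c|%:R <= 2 * rho.
  by have := IS c; have := SI (~~ c); have := IS (~~ c); rewrite negbK; lra.
pose L c := [set u | kk c + 2 * rho <= deg c u].
have noL c u v : u \in L c -> v \in L c -> ~~ edge c u v.
  rewrite !inE => hu hv; apply/negP => euv; apply: (bad (c := c)).
  by apply: (deficient_seeded (dec c) euv); have := def c; lra.
have LU : t <= #|L false|%:R + #|L true|%:R.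
  rewrite -natrD ler_nat -cardsT; have [le _] := leq_card_setU (L false) (L true).
  apply: leq_trans le; apply: subset_leq_card; apply/subsetP => u _.
  rewrite !inE; have := deg_sum u; have := kk_sum; have := rho_ge0.
  by case: leP => //= lt; case: leP => //= lt2; lra.
(* If [L c] were large, its members would have large degree in the other colour, hence lie in
   [L (~~ c)] too and span no edge of either colour. The two strict bounds sum to at most [t],
   against [LU]; this spends the whole [8 * rho]. *)
have Lsmall c : #|L c|%:R < kk (~~ c) + 4 * rho.
  rewrite ltNge; apply/negP => big.
  have sub u : u \in L c -> u \in L (~~ c).
    move=> uL; rewrite inE; have := deg_other (fun v vL => noL c u v uL vL).
    by lra.
  have := @no_edges_small (L c) c (noL c) _.
  move=> /(_ (fun u v uL vL => noL _ u v (sub u uL) (sub v vL))).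
  by have := rho_ge0; have := kk_gt0 (~~ c); lra.
have := Lsmall false; have := Lsmall true => /=; have := kk_sum; lra.
Qed.

Lemma no_bad_colours : False.
Proof.
have [c bigS] := large_S; have r0 := rho_ge0.
have k1 := kk_gt0 c; have k2 := kk_gt0 (~~ c); have ks := kk_sumc c.
have SI c' : #|S c'|%:R <= #|I c'|%:R :> R by rewrite ler_nat (card_S_le (dec c')).
have SIt c' : #|S c'|%:R + #|I c'|%:R <= t.
  by rewrite -natrD ler_nat (card_SI (dec c')).
(* Both sets [S] have at most [t / 2] elements. A large [S c] thus forces [kk (~~ c)] above
   [t / 2 - 2 * rho], and then [kk c] is so small that [S (~~ c)] is not large. *)
have I'S : #|I (~~ c) :\: S c|%:R <= rho.
  have := @I_sub_S (~~ c); rewrite negbK; apply; first exact: bad.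
  by have := SI c; have := SIt c; have := SI (~~ c); have := SIt (~~ c); lra.
have I'le : #|I (~~ c)|%:R <= #|S c|%:R + rho.
  by have := card_sub (I (~~ c)) (S c); lra.
have Spos : kk c + 6 * rho <= #|S c|%:R by lra.
have [I'big|I'small] := ltP rho #|I (~~ c)|%:R.
  have [/existsP[A /existsP[B /and3P[AI BI eAB]]]|none] := boolP [exists A, exists B,
      [&& A \in I (~~ c), B \in I (~~ c) & edge c A B]].
    (* Of the total cover [2 * t] the matching misses [2 * (#|I c| - #|S c|)], and [S (~~ c)] takes
       at most [2 * (#|S c| + rho)]. At least [2 * #|S c|] remains, up to a multiple of [rho] that
       [Spos] absorbs. *)
    have hA u : u \in I (~~ c) -> 2 * kk c <= wdeg (edge c) (w c)
        (fun v => (half_cover (D c) (s c) v)%:R) u.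
      move=> uI; have := @wdeg_ge (~~ c) u (~: S (~~ c)) _ 2
        (fun v => half_cover_le2 (D c) (s c) v); rewrite negbK.
      have no v : v \in ~: S (~~ c) -> ~~ edge (~~ c) u v.
        by rewrite inE; apply: no_edge_out uI.
      move=> /(_ no); apply: le_trans.
      have := cov_sum (dec c); rewrite (bigID (mem (S (~~ c)))) /=.
      have -> : \sum_(i | i \notin S (~~ c)) (half_cover (D c) (s c) i)%:R =
          \sum_(i in ~: S (~~ c)) (half_cover (D c) (s c) i)%:R :> R.
        by apply: eq_bigl => i; rewrite in_setC.
      have : \sum_(i in S (~~ c)) (half_cover (D c) (s c) i)%:R <= 2 * #|S (~~ c)|%:R :> R.
        rewrite mulr_natr -sumr_const; apply: ler_sum => i _.
        by have /andP[] := half_cover_le2 (D c) (s c) i.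
      by have := SI (~~ c); have := SIt c; lra.
    by apply: (bad (c := c)); apply: (seeded_of (dec c) eAB); apply: hA.
  suff : #|I (~~ c)|%:R <= rho by lra.
  apply: (@no_edges_small _ (~~ c)) => u v uI vI.
    exact: (independent (dec (~~ c))).
  rewrite negbK; move: none; rewrite negb_exists => /forallP /(_ u).
  by rewrite negb_exists => /forallP /(_ v); rewrite uI vI.
(* Now the matching in the other colour is almost perfect, so almost every
   vertex of [I c] has large degree in colour [c]; averaging these degrees
   over the matching yields the two seed clusters. *)
pose Jb := [set u in I c | kk c + 3 * rho <= deg c u].
have smallJ : #|I c :\: Jb|%:R <= rho.
  apply: (@no_edges_small _ c) => u v.
    by move=> /setDP[uI _] /setDP[vI _]; apply: (independent (dec c)).
  have big z : z \in I c :\: Jb ->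
      kk (~~ c) + (#|I (~~ c)|%:R - #|S (~~ c)|%:R) <= deg (~~ c) z.
    rewrite !inE => /andP[+ zI]; rewrite zI /= -ltNge => lt.
    have : t - 2 * rho <= deg c z + deg (~~ c) z.
      by have := deg_sum z; case: (c) => /=; lra.
    by have := ler0n R #|S (~~ c)|; lra.
  move=> uJ vJ; apply/negP => euv; apply: (bad (c := ~~ c)).
  exact: (deficient_seeded (dec (~~ c)) euv (big u uJ) (big v vJ)).
have nbJ C A : C \in Jb -> edge c A C -> A \in S c.
  by rewrite inE => /andP[CI _] eAC; apply/nbhP; exists C; rewrite // edge_sym.
have covJ : 2 * #|S c|%:R - 2 * rho <= \sum_(C in Jb) (half_cover (D c) (s c) C)%:R :> R.
  have := cov_sum (dec c); rewrite (bigID (mem Jb)) /= => E.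
  have : \sum_(i | i \notin Jb) (half_cover (D c) (s c) i)%:R <= 2 * #|~: Jb|%:R :> R.
    rewrite mulr_natr -sumr_const (eq_bigl (fun i => i \in ~: Jb)) => [|i]; last by rewrite in_setC.
    by apply: ler_sum => i _; have /andP[] := half_cover_le2 (D c) (s c) i.
  have /natr_congr := cardsC Jb; rewrite natrD.
  by have := card_sub (I c) Jb; lra.
pose g A := \sum_(C in Jb | edge c A C) w c A C * (half_cover (D c) (s c) C)%:R.
have g0 A C : 0 <= w c A C * (half_cover (D c) (s c) C)%:R by apply: mulr_ge0.
have avg : 2 * kk c * #|S c|%:R <= \sum_(A in S c) g A.
  rewrite /g; under eq_bigr => A _ do rewrite big_mkcondr /=.
  rewrite exchange_big /=.
  (* The surplus [3 * rho] in the degrees outweighs the loss [2 * rho] in the cover, because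
     [#|S c|] is at least [kk c + 6 * rho]. *)
  apply: (@le_trans _ _ (\sum_(C in Jb) (kk c + 3 * rho) * (half_cover (D c) (s c) C)%:R)).
    rewrite -mulr_sumr.
    have : 0 <= (kk c + 3 * rho) * (\sum_(C in Jb) (half_cover (D c) (s c) C)%:R
      - (2 * #|S c|%:R - 2 * rho)) by apply: mulr_ge0; lra.
    have : 0 <= rho * (#|S c|%:R - (kk c + 6 * rho)) by apply: mulr_ge0; lra.
    by have : 0 <= rho * rho; [apply: mulr_ge0|nra].
  apply: ler_sum => C CJ; rewrite -big_mkcondr /=.
  have -> : \sum_(A in S c | edge c A C) w c A C * (half_cover (D c) (s c) C)%:R =
      deg c C * (half_cover (D c) (s c) C)%:R.
    rewrite /wdeg mulr_suml; apply: eq_big => A.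
      rewrite edge_sym andbC; case: (boolP (edge c C A)) => //= e.
      by apply: (nbJ C) => //; rewrite edge_sym.
    by rewrite mulr1 w_sym.
  by apply: ler_wpM2r => //; move: CJ; rewrite inE => /andP[].
have [A AS gA] : exists2 A, A \in S c & 2 * kk c <= g A.
  apply/exists_inP; apply: contraLR avg => /exists_inPn none.
  rewrite -ltNge mulr_natr -sumr_const; apply: ltr_sum.
    have : 0 < #|S c|%:R :> R by lra.
    rewrite ltr0n => /card_gt0P[A AS]; apply/hasP; exists A; rewrite ?mem_index_enum //.
  by move=> A AS; rewrite ltNge none.
have [B BJ eAB] : exists2 B, B \in Jb & edge c A B.
  apply/exists_inP; apply: contraLR gA => /exists_inPn none.
  by rewrite -ltNge /g big_pred0 ?mulr_gt0 // => C; apply/negP => /andP[/none /negP].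
have BI : B \in I c by move: BJ; rewrite inE => /andP[].
apply: (bad (c := c)); apply: (seeded_of (dec c) eAB).
  apply: le_trans gA _; rewrite /g /wdeg big_mkcond [leRHS]big_mkcond.
  apply: ler_sum => C _; case: (boolP (edge c A C)) => eAC; rewrite ?andbF //= andbT.
  by case: ifP.
rewrite (wdeg_cov (dec c)); last first.
  by apply: contraL BI => BS; have [[_ _ dis _ _] _] := dec c; rewrite (disjointFl dis BS).
by move: BJ; rewrite inE => /andP[_]; lra.
Qed.

End BothColours.

Theorem reduced_graph : exists c, good c.
Proof.
have H c : exists p : {set T} * {set T} * (T -> T),
    decomposition c p.1.1 p.1.2 p.2.
  have [I [D [s HI]]] := half_matching (@edge_sym c).
  by exists (I, D, s).
have [f0 h0] := H false; have [f1 h1] := H true.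
pose f c := if c then f1 else f0.
have hf c : decomposition c (f c).1.1 (f c).1.2 (f c).2 by case: c.
have [g1|n1] := classic (good true); first by exists true.
have [g2|n2] := classic (good false); first by exists false.
by case: (no_bad_colours hf (fun c => if c return ~ good c then n1 else n2)).
Qed.

End Reduced.

(** * The regularity lemma *)

Section Density.
Variables (R : realFieldType) (G : finType) (e : rel G).

Definition edges_between (X Y : {set G}) : R :=
  \sum_(x in X) \sum_(y in Y) (e x y)%:R.

Definition density (X Y : {set G}) : R :=
  edges_between X Y / (#|X|%:R * #|Y|%:R).

Definition regular_pair (eps : R) (X Y : {set G}) : bool :=
  [forall X' : {set G}, forall Y' : {set G},
    [&& X' \subset X, Y' \subset Y, eps * #|X|%:R <= #|X'|%:R
      & eps * #|Y|%:R <= #|Y'|%:R] ==>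
    (`|density X' Y' - density X Y| <= eps)].

Lemma edges_between_ge0 X Y : 0 <= edges_between X Y.
Proof. by apply: sumr_ge0 => x _; apply: sumr_ge0. Qed.

Lemma edges_between_le X Y : edges_between X Y <= #|X|%:R * #|Y|%:R.
Proof.
rewrite mulrC mulr_natr -sumr_const; apply: ler_sum => x _.
by rewrite -sumr_const; apply: ler_sum => y _; rewrite lern1; case: (e x y).
Qed.

Lemma density_ge0 X Y : 0 <= density X Y.
Proof. by rewrite divr_ge0 ?edges_between_ge0 ?mulr_ge0. Qed.

Lemma density_le1 X Y : density X Y <= 1.
Proof.
have [z|nz] := eqVneq (#|X|%:R * #|Y|%:R : R) 0.
  by rewrite /density z invr0 mulr0.
rewrite ler_pdivrMr ?mul1r ?edges_between_le //.
by rewrite lt_def nz mulr_ge0.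
Qed.

Lemma densityE X Y : density X Y * (#|X|%:R * #|Y|%:R) = edges_between X Y.
Proof.
have [z|nz] := eqVneq (#|X|%:R * #|Y|%:R : R) 0; last by rewrite /density divfK.
rewrite z mulr0; apply/eqP; rewrite eq_le edges_between_ge0 /=.
by have := edges_between_le X Y; rewrite z.
Qed.

End Density.

(** * Energy of a vertex colouring *)

Section Energy.
Variables (R : realFieldType) (G : finType) (e : rel G).
Notation n := (#|G|%:R : R).
Notation edges := (edges_between R e).
Notation dens := (density R e).

Definition class (C : eqType) (c : G -> C) (u : G) : {set G} := [set v | c v == c u].

Definition block_density (C : eqType) (c : G -> C) (u v : G) : R :=
  dens (class c u) (class c v).

(** Summing over pairs of vertices weights each pair of classes by its size; without normalisation
    the upper bound is [n ^+ 2]. *)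
Definition energy (C : eqType) (c : G -> C) : R :=
  \sum_u \sum_v block_density c u v ^+ 2.

Lemma class_self (C : eqType) (c : G -> C) u : u \in class c u.
Proof. by rewrite inE. Qed.

Lemma class_eq (C : eqType) (c : G -> C) u v : c u = c v -> class c u = class c v.
Proof. by move=> E; apply/setP => x; rewrite !inE E. Qed.

Lemma class_card_neq0 (C : eqType) (c : G -> C) u : #|class c u|%:R != 0 :> R.
Proof. by rewrite pnatr_eq0 -lt0n; apply/card_gt0P; exists u; rewrite class_self. Qed.

Lemma energy_ge0 (C : eqType) (c : G -> C) : 0 <= energy c.
Proof. by apply: sumr_ge0 => u _; apply: sumr_ge0 => v _; apply: sqr_ge0. Qed.

Lemma energy_le (C : eqType) (c : G -> C) : energy c <= n ^+ 2.
Proof.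
rewrite expr2 -[X in X * _]mulr1 -mulrA mulr_natl -sumr_const; apply: ler_sum => u _.
rewrite mul1r -sumr_const; apply: ler_sum => v _.
by apply: exprn_ile1; rewrite ?density_ge0 ?density_le1.
Qed.

(* [block_density c] is the conditional expectation of the adjacency function
   on the products of classes of [c]. *)
Lemma block_averaging (C : eqType) (c : G -> C) (F : G -> G -> R) :
  (forall u u' v v', c u = c u' -> c v = c v' -> F u v = F u' v') ->
  \sum_u \sum_v block_density c u v * F u v = \sum_u \sum_v (e u v)%:R * F u v.
Proof.
move=> Finv.
pose k u := #|class c u|%:R : R.
have -> : \sum_u \sum_v block_density c u v * F u v =
    \sum_u \sum_v \sum_x \sum_y
      ((c x == c u) && (c y == c v))%:R * ((e x y)%:R * (F x y / (k x * k y))).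
  apply: eq_bigr => u _; apply: eq_bigr => v _.
  rewrite /block_density /density /edges_between !mulr_suml [LHS]big_mkcond /=.
  apply: eq_bigr => x _; rewrite inE; case: eqP => [cx|_]; last first.
    by rewrite big1 // => y _; rewrite mul0r.
  rewrite !mulr_suml [LHS]big_mkcond /=; apply: eq_bigr => y _; rewrite inE.
  case: eqP => [cy|_]; last by rewrite mul0r.
  rewrite mul1r (Finv x u y v) // /k (class_eq cx) (class_eq cy) -!mulrA.
  by congr (_ * _); rewrite mulrC.
under eq_bigr => u _ do rewrite exchange_big /=.
under eq_bigr => u _ do under eq_bigr => x _ do rewrite exchange_big /=.
rewrite exchange_big /=; apply: eq_bigr => x _.
rewrite exchange_big /=; apply: eq_bigr => y _.
have -> : \sum_u \sum_v ((c x == c u) && (c y == c v))%:R *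
    ((e x y)%:R * (F x y / (k x * k y))) =
    (e x y)%:R * (F x y / (k x * k y)) * (k x * k y).
  under eq_bigr => u _ do rewrite -mulr_suml.
  rewrite -mulr_suml mulrC; congr (_ * _).
  rewrite /k -!sum1_card !natr_sum mulr_suml [RHS]big_mkcond /=.
  apply: eq_bigr => u _; rewrite inE eq_sym; case: eqP => _ /=; last by rewrite big1.
  rewrite mul1r [RHS]big_mkcond /=; apply: eq_bigr => v _.
  by rewrite inE eq_sym; case: eqP.
by rewrite -mulrA divfK // mulf_neq0 ?class_card_neq0.
Qed.

Definition refines (C C' : eqType) (c' : G -> C') (c : G -> C) : Prop :=
  forall u v, c' u = c' v -> c u = c v.

(** Pythagoras: the coarse densities are the orthogonal projection of the fine ones. *)
Lemma energy_refine (C C' : eqType) (c : G -> C) (c' : G -> C') :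
  refines c' c ->
  energy c' = energy c +
    \sum_u \sum_v (block_density c' u v - block_density c u v) ^+ 2.
Proof.
move=> ref.
have inv u u' v v' : c u = c u' -> c v = c v' ->
    block_density c u v = block_density c u' v'.
  by move=> cu cv; rewrite /block_density (class_eq cu) (class_eq cv).
have E1 := block_averaging inv.
have inv' u u' v v' : c' u = c' u' -> c' v = c' v' ->
    block_density c u v = block_density c u' v'.
  by move=> cu cv; apply: inv; apply: ref.
have E2 := block_averaging inv'.
have -> : \sum_u \sum_v (block_density c' u v - block_density c u v) ^+ 2 =
    energy c' - 2 * (\sum_u \sum_v block_density c' u v * block_density c u v) +
    energy c.
  rewrite mulr_sumr -sumrB -big_split /=; apply: eq_bigr => u _.
  rewrite mulr_sumr -sumrB -big_split /=; apply: eq_bigr => v _.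
  by rewrite sqrrB mulr_natl.
have -> : energy c = \sum_u \sum_v block_density c u v * block_density c u v.
  by apply: eq_bigr => u _; apply: eq_bigr => v _; rewrite expr2.
rewrite E2 -E1; lra.
Qed.

Lemma energy_mono (C C' : eqType) (c : G -> C) (c' : G -> C') :
  refines c' c -> energy c <= energy c'.
Proof.
move=> /energy_refine ->; rewrite lerDl.
by apply: sumr_ge0 => u _; apply: sumr_ge0 => v _; apply: sqr_ge0.
Qed.

Lemma sum_sqr_ge (I : finType) (A : {set I}) (h : I -> R) (m : R) :
  \sum_(i in A) h i = m * #|A|%:R -> m ^+ 2 * #|A|%:R <= \sum_(i in A) h i ^+ 2.
Proof.
move=> Es; have : 0 <= \sum_(i in A) (h i - m) ^+ 2.
  by apply: sumr_ge0 => i _; apply: sqr_ge0.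
have -> : \sum_(i in A) (h i - m) ^+ 2 =
    \sum_(i in A) h i ^+ 2 - 2 * m * (\sum_(i in A) h i) + m ^+ 2 * #|A|%:R.
  rewrite mulr_natr -sumr_const mulr_sumr -sumrB -big_split /=.
  by apply: eq_bigr => i _; rewrite sqrrB mulr_natl -mulrnAr mulrC; lra.
by rewrite Es; nra.
Qed.

(* Defect form of the Cauchy-Schwarz inequality on one block. *)
Lemma block_gain (C C' : eqType) (c : G -> C) (c' : G -> C') (a b : {set G})
    (P Q : {set G}) (eps : R) :
  refines c' c -> 0 < eps ->
  (forall u v, u \in a -> v \in b -> block_density c u v = dens a b) ->
  (forall u v, c' u = c' v -> (u \in P) = (v \in P)) ->
  (forall u v, c' u = c' v -> (u \in Q) = (v \in Q)) ->
  P \subset a -> Q \subset b ->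
  eps * #|a|%:R <= #|P|%:R -> eps * #|b|%:R <= #|Q|%:R ->
  eps < `|dens P Q - dens a b| ->
  eps ^+ 4 * (#|a|%:R * #|b|%:R) <=
    \sum_(u in a) \sum_(v in b) (block_density c' u v - block_density c u v) ^+ 2.
Proof.
move=> ref e0 bd Pinv Qinv Pa Qb hP hQ irr.
pose h (p : G * G) := block_density c' p.1 p.2 - block_density c p.1 p.2.
have sumE (A B : {set G}) (F : G -> G -> R) :
    \sum_(u in A) \sum_(v in B) F u v = \sum_(p in setX A B) F p.1 p.2.
  by rewrite pair_big; apply: eq_bigl => -[u v]; rewrite in_setX.
have avg : \sum_(u in P) \sum_(v in Q) block_density c' u v = edges P Q.
  have := @block_averaging _ c' (fun u v => (u \in P)%:R * (v \in Q)%:R) _.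
  move=> avg; rewrite /edges_between.
  have E (F : G -> G -> R) : \sum_(u in P) \sum_(v in Q) F u v =
      \sum_u \sum_v F u v * ((u \in P)%:R * (v \in Q)%:R).
    rewrite big_mkcond; apply: eq_bigr => u _; case: (u \in P); last first.
      by rewrite big1 // => v _; rewrite mul0r mulr0.
    rewrite big_mkcond; apply: eq_bigr => v _; rewrite mul1r.
    by case: (v \in Q); rewrite ?mulr1 ?mulr0.
  rewrite !E; apply: avg => u u' v v' /Pinv -> /Qinv ->; by [].
have Esum : \sum_(p in setX P Q) h p = (dens P Q - dens a b) * #|setX P Q|%:R.
  rewrite -(sumE P Q (fun u v => block_density c' u v - block_density c u v)).
  under eq_bigr => u _ do rewrite sumrB.
  rewrite sumrB avg cardsX natrM mulrBl densityE; congr (_ - _).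
  rewrite -natrM -cardsX -sum1_card natr_sum mulr_sumr.
  rewrite sumE; apply: eq_bigr => -[u v]; rewrite in_setX mulr1 => /andP[uP vQ] /=.
  by apply: bd; [apply: (subsetP Pa)|apply: (subsetP Qb)].
have gain := sum_sqr_ge Esum.
apply: (@le_trans _ _ (\sum_(p in setX P Q) h p ^+ 2)); last first.
  rewrite sumE -/h [leRHS](bigID (mem (setX P Q))) /= -[leLHS]addr0; apply: lerD.
    rewrite le_eqVlt; apply/orP; left; apply/eqP; apply: eq_bigl => -[u v].
    rewrite !in_setX /=; case: (boolP (u \in P)) => uP; case: (boolP (v \in Q)) => vQ;
      rewrite ?andbF // !andbT.
    by rewrite (subsetP Pa) ?(subsetP Qb).
  by apply: sumr_ge0 => p _; apply: sqr_ge0.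
apply: le_trans gain; rewrite cardsX natrM.
have d2 : eps ^+ 2 <= (dens P Q - dens a b) ^+ 2.
  rewrite -[leRHS]real_normK ?num_real //; apply: lerXn2r; rewrite ?nnegrE //; exact: ltW.
(* Two factors [eps] come from the deviation of the density, the other two from the relative sizes
   of [P] and [Q]. *)
have -> : eps ^+ 4 * (#|a|%:R * #|b|%:R) =
    eps ^+ 2 * ((eps * #|a|%:R) * (eps * #|b|%:R)).
  by rewrite !exprS expr0; lra.
apply: ler_pM => //; first exact: sqr_ge0.
  by rewrite !mulr_ge0 // ltW.
by apply: ler_pM => //; rewrite mulr_ge0 // ltW.
Qed.

End Energy.

Lemma card_ord_lt K q : (q <= K)%N -> #|[set k : 'I_K | (k < q)%N]| = q.
Proof.
move=> qK; have wi : injective (widen_ord qK) by move=> i j [] /val_inj.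
rewrite -[RHS]card_ord -(card_imset _ wi).
apply: eq_card => k; rewrite inE; apply/idP/imsetP => [kq|[j _ ->]].
  by exists (Ordinal kq) => //; apply: val_inj.
by rewrite /= ltn_ord.
Qed.

(** * Cutting classes into chunks of equal size *)

Section Chop.
Local Open Scope nat_scope.
Variables (G : finType) (C : finType) (c : G -> C) (s : nat).
Hypothesis s0 : 0 < s.
Let cell a : {set G} := [set v | c v == a].

(** A class is cut along its enumeration into runs of length [s]. By [chop_index] the run number
    fits the ordinal type, so [inord] never takes its default. *)
Definition chop (v : G) : C * 'I_(#|G| %/ s).+1 :=
  (c v, inord (index v (enum (cell (c v))) %/ s)).

Definition full_chunks : {set C * 'I_(#|G| %/ s).+1} :=
  [set p : C * 'I_(#|G| %/ s).+1 | p.2 < #|cell p.1| %/ s].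

Lemma cell_div_le a : #|cell a| %/ s <= #|G| %/ s.
Proof. by rewrite leq_div2r // max_card. Qed.

Lemma chop_index v : chop v = (c v, inord (index v (enum (cell (c v))) %/ s)) /\
  index v (enum (cell (c v))) %/ s < (#|G| %/ s).+1.
Proof.
split=> //; rewrite ltnS; apply: leq_trans (cell_div_le (c v)).
rewrite leq_div2r // ltnW // cardE index_mem mem_enum inE //.
Qed.

Lemma card_full_chunk p : p \in full_chunks -> #|[set v | chop v == p]| = s.
Proof.
case: p => a k; rewrite inE /= => kq.
have le : k * s + s <= #|cell a| by rewrite -mulSnr -leq_divRL.
have /card_gt0P[v0 _] : 0 < #|cell a| by lia.
have sz : size (enum (cell a)) = #|cell a| by rewrite cardE.
pose f (r : 'I_s) := nth v0 (enum (cell a)) (k * s + r).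
have lt (r : 'I_s) : k * s + r < size (enum (cell a)) by have := ltn_ord r; rewrite sz; lia.
have fi : injective f.
  move=> r r' /eqP; rewrite /f nth_uniq ?enum_uniq // eqn_add2l => /eqP E.
  exact: val_inj.
rewrite -[RHS](card_ord s) -(card_imset _ fi); apply: eq_card => v.
rewrite inE; apply/eqP/imsetP.
  have [E lk] := chop_index v; rewrite E => -[cv /(congr1 val)]; rewrite /= inordK //.
  rewrite cv => Ei; have vin : v \in enum (cell a) by rewrite mem_enum inE cv.
  exists (Ordinal (ltn_pmod (index v (enum (cell a))) s0)) => //.
  by rewrite /f /= -Ei -divn_eq nth_index.
case=> r _ ->; have fin : f r \in cell a by rewrite -mem_enum mem_nth.
have cf : c (f r) = a by move: fin; rewrite inE => /eqP.
have [-> lk] := chop_index (f r); rewrite cf; congr (_, _); apply: val_inj.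
rewrite /= inordK -{1}cf // cf /f index_uniq ?enum_uniq //.
by rewrite divnMDl // (divn_small (ltn_ord r)) addn0.
Qed.

(** At most one chunk of each class is incomplete, a loss below [s] per class. *)
Lemma card_full_chunks : #|G| <= #|full_chunks| * s + #|C| * s.
Proof.
have -> : #|full_chunks| = \sum_a #|cell a| %/ s.
  rewrite -sum1_card (eq_bigl (fun p : C * 'I_(#|G| %/ s).+1 => true && (p.2 < #|cell p.1| %/ s)));
    last by move=> p; rewrite inE.
  rewrite -(pair_big_dep xpredT (fun a (k : 'I_(#|G| %/ s).+1) => k < #|cell a| %/ s) (fun _ _ => 1)) /=.
  apply: eq_bigr => a _; rewrite sum1dep_card card_ord_lt //.
  by rewrite leqW // cell_div_le.
rewrite -[leqLHS](_ : \sum_(a : C) #|cell a| = _); last first.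
  rewrite -[RHS]cardsT -sum1_card (partition_big c xpredT) //=.
  by apply: eq_bigr => a _; rewrite -sum1_card; apply: eq_bigl => v; rewrite !inE.
rewrite big_distrl /= -[X in _ <= _ + X]sum_nat_const -big_split /=.
apply: leq_sum => a _; rewrite {1}(divn_eq #|cell a| s) leq_add2l.
by rewrite ltnW // ltn_pmod.
Qed.

Lemma refines_chop : refines chop c.
Proof. by move=> u v []. Qed.

End Chop.

(** * Energy increment from irregular pairs *)

Section Refine.
Variables (R : realFieldType) (G : finType) (e : rel G) (C : finType) (c : G -> C).
Variables (F : {set C}) (s : nat) (eps : R).
Hypothesis eps0 : 0 < eps.
Let V (a : C) : {set G} := [set v | c v == a].
Hypothesis cardV : forall a, a \in F -> #|V a| = s.

Definition irregular (p : C * C) : bool :=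
  [&& p.1 \in F, p.2 \in F & ~~ regular_pair e eps (V p.1) (V p.2)].

Definition witness (a b : C) : {set G} * {set G} :=
  odflt (set0, set0) [pick PQ : {set G} * {set G} |
    [&& PQ.1 \subset V a, PQ.2 \subset V b,
        eps * #|V a|%:R <= #|PQ.1|%:R, eps * #|V b|%:R <= #|PQ.2|%:R
      & eps < `|density R e PQ.1 PQ.2 - density R e (V a) (V b)|]].

Lemma witness_sub a b : (witness a b).1 \subset V a /\ (witness a b).2 \subset V b.
Proof.
rewrite /witness; case: pickP => [PQ /and5P[-> -> _ _ _]|_] //=.
by rewrite !sub0set.
Qed.

Lemma witnessP a b : ~~ regular_pair e eps (V a) (V b) ->
  [/\ eps * #|V a|%:R <= #|(witness a b).1|%:R,
      eps * #|V b|%:R <= #|(witness a b).2|%:R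
    & eps < `|density R e (witness a b).1 (witness a b).2 -
              density R e (V a) (V b)|].
Proof.
move=> irr; rewrite /witness; case: pickP => [PQ /and5P[_ _ ? ? ?]|none] //=.
case/negP: irr; apply/forallP => P; apply/forallP => Q; apply/implyP.
move=> /and4P[PV QV hP hQ]; rewrite leNgt; apply/negP => big.
by have := none (P, Q); rewrite /= PV QV hP hQ big.
Qed.

(** The common refinement of [c] by all witnesses: a vertex records in which of those cut from its
    own class it lies, as first or as second member of a pair. *)
Definition witness_colouring (v : G) : C * {set C} * {set C} :=
  (c v, [set b | v \in (witness (c v) b).1], [set a | v \in (witness a (c v)).2]).

Lemma refines_witness : refines witness_colouring c.
Proof. by move=> u v []. Qed.

Lemma energy_witness :
  energy R e c + eps ^+ 4 * (s%:R * s%:R) * #|[set p | irregular p]|%:R <=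
  energy R e witness_colouring.
Proof.
rewrite (energy_refine R e refines_witness) lerD2l.
set H := fun u v => (block_density R e witness_colouring u v - block_density R e c u v) ^+ 2.
have H0 u v : 0 <= H u v by apply: sqr_ge0.
have -> : \sum_u \sum_v H u v = \sum_(p : C * C) \sum_(u in V p.1) \sum_(v in V p.2) H u v.
  rewrite (partition_big c xpredT) //= -(pair_bigA _ (fun a b => \sum_(u in V a) \sum_(v in V b) H u v)) /=.
  apply: eq_bigr => a _; rewrite [RHS]exchange_big /=.
  apply: eq_big => [u|u _]; first by rewrite /V inE.
  rewrite (partition_big c xpredT) //=; apply: eq_bigr => b _.
  by apply: eq_bigl => v; rewrite /V inE.
rewrite (bigID irregular) /= -[leLHS]addr0; apply: lerD; last first.
  by apply: sumr_ge0 => p _; apply: sumr_ge0 => u _; apply: sumr_ge0.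
rewrite mulr_natr -sumr_const [leLHS](eq_bigl irregular); last by move=> p; rewrite inE.
apply: ler_sum => -[a b] /and3P[/= aF bF irr].
have [hP hQ hd] := witnessP irr; have [sP sQ] := witness_sub a b.
rewrite -{1}(cardV aF) -(cardV bF).
apply: (block_gain refines_witness eps0 _ _ _ sP sQ hP hQ hd).
- move=> u v; rewrite !inE => /eqP ua /eqP vb.
  rewrite /block_density; congr density; apply/setP => x; rewrite !inE;
    by rewrite ?ua ?vb.
- move=> u v E; have E1 : c u = c v := refines_witness E.
  have [ua|na] := eqVneq (c u) a.
    have /setP/(_ b) : [set b | u \in (witness (c u) b).1] =
      [set b | v \in (witness (c v) b).1] by case: E.
    by rewrite !inE -E1 ua.
  have out x : c x != a -> (x \in (witness a b).1) = false.
    by move=> xa; apply: contraNF xa => /(subsetP sP); rewrite inE.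
  by rewrite !out // -E1.
- move=> u v E; have E1 : c u = c v := refines_witness E.
  have [ub|nb] := eqVneq (c u) b.
    have /setP/(_ a) : [set a | u \in (witness a (c u)).2] =
      [set a | v \in (witness a (c v)).2] by case: E.
    by rewrite !inE -E1 ub.
  have out x : c x != b -> (x \in (witness a b).2) = false.
    by move=> xb; apply: contraNF xb => /(subsetP sQ); rewrite inE.
  by rewrite !out // -E1.
Qed.

End Refine.

Lemma chunk_count_le (s m : nat) : (0 < s)%N -> (s.+1 * m <= (2 * m).+1 * s)%N.
Proof. nia. Qed.

Lemma chunk_count_ge (t n m s r : nat) : (0 < s)%N -> (s * m <= n)%N ->
  (n <= 2 * (t * s))%N -> (2 * r <= m)%N -> (r <= t)%N.
Proof. nia. Qed.

Section Regularity.
Variables (R : archiRealFieldType) (eps : R) (t0 : nat).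
Hypotheses (eps0 : 0 < eps) (eps1 : eps <= 1 / 2).

Definition regular_clusters (M : nat) (G : finType) (e : rel G) : Prop :=
  exists (T : finType) (s : nat) (V : T -> {set G}),
  [/\ (t0 <= #|T| <= M)%N, forall i, #|V i| = s,
      forall i j, i != j -> [disjoint V i & V j],
      (1 - eps) * #|G|%:R <= #|T|%:R * s%:R
    & #|[set p : T * T | ~~ regular_pair e eps (V p.1) (V p.2)]|%:R <=
        eps * #|T|%:R ^+ 2].

(** Gain of one refinement relative to [n ^+ 2]: a factor [eps ^+ 4] on each irregular pair, more
    than a fraction [eps] of irregular pairs, and full chunks covering at least half of the
    vertices, whence the 4. *)
Let gamma : R := eps ^+ 5 / 4.

(** [k] bounds the refinements still possible and [L] the number of classes. At [k = 0] the energy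
    would exceed its maximum; otherwise either the full chunks are regular enough or a refinement
    gains [gamma] and lowers [k]. *)
Lemma regularity_step (k : nat) (L : nat) : exists M : nat,
  forall (G : finType) (e : rel G) (C : finType) (c : G -> C),
    (#|C| <= L)%N -> (M <= #|G|)%N ->
    (1 - k%:R * gamma) * #|G|%:R ^+ 2 < energy R e c ->
    regular_clusters M e.
Proof.
elim: k L => [|k IH] L.
  exists 0%N => G e C c _ _; rewrite mul0r subr0 mul1r => lt.
  by have := energy_le R e c; lra.
(* Chunks have size about [n / m]. With [m >= L / eps] the incomplete ones lose at most [eps * n]
   vertices, and with [m >= 2 * t0] at least [t0] chunks are full. *)
pose m := (maxn (Num.truncn (L%:R / eps)).+1 (2 * t0)).+1.
have mL : L%:R <= eps * m%:R.
  rewrite mulrC -ler_pdivrMr //; apply: ltW.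
  apply: lt_le_trans (truncnS_gt _) _; by rewrite ler_nat leqW // leq_maxl.
have mt : (2 * t0 <= m)%N by rewrite leqW // leq_maxr.
have m0 : (0 < m)%N by [].
pose L1 := (L * (2 * m).+1)%N.
have [M0 HM0] := IH (L1 * 2 ^ L1 * 2 ^ L1)%N.
exists (maxn (2 * m) M0) => G e C c cL; rewrite geq_max => /andP[Gm GM] en.
pose s := (#|G| %/ m)%N.
have s0 : (0 < s)%N by rewrite divn_gt0 //; lia.
have sm : (s * m <= #|G|)%N by apply: leq_trunc_div.
have Gs : (#|G| %/ s <= 2 * m)%N.
  rewrite -ltnS ltn_divLR //.
  exact: leq_trans (ltn_ceil #|G| m0) (chunk_count_le _ s0).
pose c1 := chop c s; pose F := full_chunks c s.
have en1 := energy_mono R e (@refines_chop _ _ c s).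
have cF := card_full_chunks c s0; rewrite -/F in cF.
have FsR : (1 - eps) * #|G|%:R <= #|F|%:R * s%:R.
  have h1 : #|G|%:R <= #|F|%:R * s%:R + #|C|%:R * s%:R :> R.
    by rewrite -!natrM -natrD ler_nat.
  have h2 : #|C|%:R <= eps * m%:R by apply: le_trans mL; rewrite ler_nat.
  have h3 : s%:R * m%:R <= #|G|%:R :> R by rewrite -natrM ler_nat.
  have h4 : #|C|%:R * s%:R <= eps * m%:R * s%:R by apply: ler_wpM2r.
  have : eps * (s%:R * m%:R) <= eps * #|G|%:R by rewrite ler_pM2l.
  lra.
have G0 : 0 < #|G|%:R :> R.
  by rewrite ltr0n; apply: leq_trans Gm; rewrite muln_gt0.
have Fs2 : #|G|%:R <= 2 * (#|F|%:R * s%:R) :> R.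
  have : 0 <= (1 / 2 - eps) * #|G|%:R.
    by apply: mulr_ge0; [rewrite subr_ge0|exact: ltW].
  by lra.
have Fle : (#|F| <= 2 * m)%N.
  have : (#|F| * s <= #|G|)%N.
    have <- : (\sum_(p in F) #|[set v | c1 v == p]| = #|F| * s)%N.
      by rewrite -sum_nat_const; apply: eq_bigr => p; apply: card_full_chunk.
    rewrite -[leqRHS]cardsT -[leqRHS]sum1_card (partition_big c1 xpredT) //=.
    rewrite [leqRHS](bigID (mem F)) /=; apply: leq_trans (leq_addr _ _).
    apply: leq_sum => p _; rewrite -sum1_card; apply: eq_leq.
    by apply: eq_bigl => v; rewrite !inE.
  by rewrite -leq_divRL // => /leq_trans; apply.
have Fge : (t0 <= #|F|)%N.
  have : (#|G| <= 2 * (#|F| * s))%N by rewrite -(ler_nat R) !natrM.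
  by move=> le; apply: chunk_count_ge s0 sm le mt.
have [irr|reg] := ltP (eps * #|F|%:R ^+ 2) #|[set p | irregular e c1 F eps p]|%:R.
  have [T [s' [V [/andP[h1 h2] h3 h4 h5 h6]]]] : regular_clusters M0 e.
    apply: (HM0 _ _ _ (witness_colouring e c1 eps)) => //.
      have N1 : (#|{: C * 'I_(#|G| %/ s).+1}| <= L1)%N.
        by rewrite card_prod card_ord leq_mul.
      have card_set (T : finType) : #|{set T}| = (2 ^ #|T|)%N.
        by rewrite -[LHS]cardsT -powersetT card_powerset cardsT.
      by rewrite 2!card_prod !card_set !leq_mul ?leq_pexp2l.
    have cV a : a \in F -> #|[set v | c1 v == a]| = s by apply: card_full_chunk.
    apply: lt_le_trans (energy_witness e eps0 cV).
    have E : eps ^+ 4 * (s%:R * s%:R) * (eps * #|F|%:R ^+ 2) <=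
        eps ^+ 4 * (s%:R * s%:R) * #|[set p | irregular e c1 F eps p]|%:R.
      apply: ler_wpM2l; last exact: ltW.
      by apply: mulr_ge0; [exact: exprn_ge0 (ltW eps0)|exact: mulr_ge0].
    have : gamma * #|G|%:R ^+ 2 <= eps ^+ 4 * (s%:R * s%:R) * (eps * #|F|%:R ^+ 2).
      have -> : eps ^+ 4 * (s%:R * s%:R) * (eps * #|F|%:R ^+ 2) =
         gamma * (2 * (#|F|%:R * s%:R)) ^+ 2 by rewrite /gamma; field.
      apply: ler_wpM2l; first by rewrite divr_ge0 // exprn_ge0 // ltW.
      by apply: lerXn2r; rewrite // nnegrE ?ler0n // !mulr_ge0.
    move: en1 en E; rewrite -natr1 mulrDl; lra.
  by exists T, s', V; split=> //; rewrite h1 leq_max h2 orbT.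
exists {p | p \in F}, s, (fun p => [set v | c1 v == val p]); split.
- by rewrite card_sig Fge leq_max Fle.
- by move=> p; apply: card_full_chunk (valP p).
- move=> i j nij; rewrite disjoints_subset; apply/subsetP => v; rewrite !inE.
  by move=> /eqP ->; rewrite (inj_eq val_inj).
- by rewrite card_sig.
- rewrite card_sig; apply: le_trans reg; rewrite ler_nat.
  pose g (p : {p | p \in F} * {p | p \in F}) := (val p.1, val p.2).
  rewrite -(card_imset (f := g)) => [|[a b] [a' b'] [/val_inj -> /val_inj ->] //].
  apply: subset_leq_card; apply/subsetP => q /imsetP[[a b]]; rewrite inE /= => irr ->.
  by rewrite inE /irregular /= !(valP a) !(valP b) irr.
Qed.

Lemma regularity : exists M : nat, forall (G : finType) (e : rel G),
  (M <= #|G|)%N -> regular_clusters M e.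
Proof.
have g0 : 0 < gamma by rewrite divr_gt0 // exprn_gt0.
(* The one-class colouring has energy at least 0, so [k * gamma > 1] starts the induction. *)
pose k := (Num.truncn gamma^-1).+1.
have kg : 1 < k%:R * gamma.
  by rewrite -ltr_pdivrMr // div1r; apply: truncnS_gt.
have [M HM] := regularity_step k 1.
exists M.+1 => G e GM.
have G0 : 0 < #|G|%:R :> R by rewrite ltr0n (leq_trans _ GM).
have [T [s [V [/andP[h1 h2] h3 h4 h5 h6]]]] : regular_clusters M e.
  apply: (HM _ _ _ (fun=> tt)); [by rewrite card_unit|exact: ltnW|].
  apply: lt_le_trans (energy_ge0 R e _); rewrite nmulr_rlt0 ?exprn_gt0 //.
  by rewrite subr_lt0.
by exists T, s, V; split; rewrite ?h1 // leqW.
Qed.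

End Regularity.

Lemma regular_pair_sym (R : realFieldType) (G : finType) (e : rel G) (eps : R) X Y :
  symmetric e -> regular_pair e eps X Y = regular_pair e eps Y X.
Proof.
move=> es; suff H A B : regular_pair e eps A B -> regular_pair e eps B A.
  by apply/idP/idP; apply: H.
have dC (P Q : {set G}) : density R e P Q = density R e Q P.
  rewrite /density /edges_between exchange_big /= [X in _ / X]mulrC.
  by congr (_ / _); apply: eq_bigr => x _; apply: eq_bigr => y _; rewrite es.
move=> /forallP H; apply/forallP => P; apply/forallP => Q.
apply/implyP => /and4P[PA QB hP hQ]; rewrite dC (dC B A).
by have /forallP/(_ P)/implyP := H Q; apply; rewrite PA QB hP hQ.
Qed.

(** Clusters in more than [eta * #|T|] irregular pairs are discarded; by [eps <= eta ^+ 2] they are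
    at most [eta * #|T|]. Since at least half of the clusters remain, irregular partners amount to a
    fraction [2 * eta] of them, and another [eta] pays for the cluster itself. *)
Lemma regular_clusters_degree (R : archiRealFieldType) (eta eps : R) (t0 : nat) :
  0 < eta -> eta <= 1 / 4 -> 0 < eps -> eps <= eta ^+ 2 ->
  exists M : nat, forall (G : finType) (e : rel G), (M <= #|G|)%N ->
  exists (T : finType) (s : nat) (V : T -> {set G}),
  [/\ (t0 <= #|T| <= M)%N, forall i, #|V i| = s,
      forall i j, i != j -> [disjoint V i & V j],
      (1 - 2 * eta) * #|G|%:R <= #|T|%:R * s%:R
    & forall i, #|[set j | ~~ ((i != j) && regular_pair e eps (V i) (V j))]|%:R <=
        3 * eta * #|T|%:R].
Proof.
move=> eta0 eta1 eps0 epseta.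
pose t1 := maxn (2 * t0) (2 * (Num.truncn eta^-1).+1).
have eta2 : eta ^+ 2 <= 1 / 4 * eta by rewrite expr2 ler_pM2r.
have eps1 : eps <= 1 / 2 by lra.
have [M HM] := regularity t1 eps0 eps1.
exists M => G e GM; have [T [s [V [/andP[h1 h2] h3 h4 h5 h6]]]] := HM G e GM.
pose irr i := [set j | ~~ regular_pair e eps (V i) (V j)].
pose good i := #|irr i|%:R <= eta * #|T|%:R.
have T0 : 0 < #|T|%:R :> R by rewrite ltr0n; apply: leq_trans h1; rewrite leq_max muln_gt0 orbT.
have few : #|[set i | ~~ good i]|%:R <= eta * #|T|%:R.
  have : #|[set i | ~~ good i]|%:R * (eta * #|T|%:R) <= eta ^+ 2 * #|T|%:R ^+ 2.
    apply: (@le_trans _ _ (eps * #|T|%:R ^+ 2)); last first.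
      by apply: ler_wpM2r => //; apply: exprn_ge0.
    apply: le_trans h6; rewrite [leLHS]mulrC [leLHS]mulr_natr -sumr_const.
    apply: (@le_trans _ _ (\sum_(i in [set i | ~~ good i]) #|irr i|%:R)).
      by apply: ler_sum => i; rewrite inE -ltNge => /ltW.
    rewrite -natr_sum ler_nat.
    have -> : #|[set p | ~~ regular_pair e eps (V p.1) (V p.2)]| = (\sum_i #|irr i|)%N.
      rewrite -sum1_card (eq_bigl (fun p : T * T => true && (p.2 \in irr p.1)));
        last by move=> p; rewrite !inE.
      rewrite -(pair_big_dep xpredT (fun i j => j \in irr i) (fun _ _ => 1%N)) /=.
      by apply: eq_bigr => i _; rewrite sum1_card.
    by rewrite [leqRHS](bigID (mem [set i | ~~ good i])) leq_addr.
  have -> : eta ^+ 2 * #|T|%:R ^+ 2 = eta * #|T|%:R * (eta * #|T|%:R) by ring.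
  by rewrite ler_pM2r // mulr_gt0.
have cT : #|T|%:R = #|[set i | good i]|%:R + #|[set i | ~~ good i]|%:R :> R.
  rewrite -natrD -(cardsC [set i | good i]); congr (_ + _)%:R.
  by apply: eq_card => i; rewrite !inE.
have goodT : (1 - eta) * #|T|%:R <= #|[set i | good i]|%:R by lra.
have goodT2 : #|T|%:R <= 2 * #|[set i | good i]|%:R :> R.
  have : 0 <= (1 / 2 - eta) * #|T|%:R by apply: mulr_ge0; lra.
  by lra.
have cS : #|{: {i | good i}}| = #|[set i | good i]|.
  by rewrite card_sig; apply: eq_card => i; rewrite !inE.
exists {i | good i}, s, (fun i => V (val i)); rewrite !cS; split=> //.
- apply/andP; split.
    have : (#|T| <= 2 * #|[set i | good i]|)%N by rewrite -(ler_nat R) natrM.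
    move=> le; rewrite -(@leq_pmul2l 2) //; apply: leq_trans le.
    by apply: leq_trans h1; apply: leq_maxl.
  by apply: leq_trans (max_card _) h2.
- by move=> i j nij; apply: h4.
- have : (1 - eta) * ((1 - eps) * #|G|%:R) <= (1 - eta) * (#|T|%:R * s%:R).
    by apply: ler_wpM2l => //; lra.
  have : (1 - eta) * #|T|%:R * s%:R <= #|[set i | good i]|%:R * s%:R by apply: ler_wpM2r.
  have : 0 <= (eta - eps) * #|G|%:R by apply: mulr_ge0 => //; lra.
  have : 0 <= eta * eps * #|G|%:R by rewrite !mulr_ge0 // ltW.
  nra.
- move=> i; have gi : good (val i) := valP i.
  have : #|[set j : {i | good i} | ~~ ((i != j) && regular_pair e eps (V (val i)) (V (val j)))]|%:R
      <= 1 + #|irr (val i)|%:R :> R.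
    rewrite nat1r ler_nat -(card_imset _ val_inj).
    apply: (@leq_trans #|val i |: irr (val i)|); last first.
      by rewrite cardsU1; case: (_ \notin _).
    apply: subset_leq_card; apply/subsetP => j /imsetP[k]; rewrite !inE negb_and negbK.
    by move=> /orP[/eqP -> ->|nr ->]; rewrite ?eqxx // nr orbT.
  have : 1 <= eta * #|[set i | good i]|%:R.
    rewrite mulrC -ler_pdivrMr // div1r; apply: ltW; apply: lt_le_trans (truncnS_gt _) _.
    have : (2 * (Num.truncn eta^-1).+1 <= #|T|)%N by apply: leq_trans h1; rewrite leq_maxr.
    by rewrite -(ler_nat R) natrM; lra.
  have : eta * #|T|%:R <= eta * (2 * #|[set i | good i]|%:R) by rewrite ler_pM2l.
  by move: gi; rewrite /good; lra.
Qed.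

(** * Embedding trees into regular clusters *)

Lemma disjoint_pieces (G I : finType) (U : {set G}) (f : I -> nat) :
  (\sum_i f i <= #|U|)%N ->
  exists Q : I -> {set G}, [/\ forall i, #|Q i| = f i, forall i, Q i \subset U
    & forall i j v, v \in Q i -> v \in Q j -> i = j].
Proof.
move=> le; pose S := {i : I & 'I_(f i)}.
have cS : #|{: S}| = (\sum_i f i)%N.
  by rewrite card_tagged sumnE big_map big_enum; apply: eq_bigr => i _; rewrite card_ord.
have le' : (#|{: S}| <= #|U|)%N by rewrite cS.
pose h (x : S) := enum_val (widen_ord le' (enum_rank x)).
have hi : injective h.
  by move=> x y /enum_val_inj [] /val_inj /enum_rank_inj.
exists (fun i => [set h (Tagged (fun i => 'I_(f i)) r) | r in [set: 'I_(f i)]]); split.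
- move=> i; rewrite card_imset ?cardsT ?card_ord // => r r' /hi /eqP.
  by rewrite eq_Tagged => /eqP.
- by move=> i; apply/subsetP => v /imsetP[r _ ->]; apply: enum_valP.
- by move=> i j v /imsetP[r _ ->] /imsetP[r' _ /hi] /(congr1 tag).
Qed.

Lemma subset_of_card (G : finType) (A : {set G}) (k : nat) : (k <= #|A|)%N ->
  exists2 B : {set G}, B \subset A & #|B| = k.
Proof.
move=> kA; have [|Q [cQ sQ _]] := @disjoint_pieces _ unit A (fun=> k).
  by rewrite big_const card_unit /= addn0.
by exists (Q tt).
Qed.

Section LowDegree.
Variables (R : realFieldType) (G : finType) (e : rel G).

Lemma edges_between_deg (X Y : {set G}) :
  edges_between R e X Y = \sum_(x in X) #|[set y in Y | e x y]|%:R.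
Proof.
apply: eq_bigr => x _; rewrite -sum1_card natr_sum [LHS]big_mkcond [RHS]big_mkcond /=.
by apply: eq_bigr => y _; rewrite inE; case: (y \in Y); case: (e x y).
Qed.

(** Too many low-degree vertices would form with [Y] a pair of density below
    [density R e X Y0 - eps]. *)
Lemma few_low_degree (eps d : R) (X Y0 Y : {set G}) :
  regular_pair e eps X Y0 -> Y \subset Y0 -> eps * #|Y0|%:R <= #|Y|%:R ->
  0 <= eps -> d <= density R e X Y0 - eps ->
  #|[set v in X | #|[set w in Y | e v w]|%:R < d * #|Y|%:R]|%:R <= eps * #|X|%:R.
Proof.
move=> reg YY0 hY e0 hd; set B := [set v in X | _].
rewrite leNgt; apply/negP => big.
have B0 : (0 < #|B|)%N.
  by rewrite -(ltr0n R); apply: le_lt_trans big; apply: mulr_ge0.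
have BX : B \subset X by apply/subsetP => v; rewrite inE => /andP[].
have /forallP/(_ B)/forallP/(_ Y)/implyP := reg.
rewrite BX YY0 hY (ltW big) => /(_ isT); rewrite ler_norml => /andP[lo _].
have : edges_between R e B Y < d * #|Y|%:R * #|B|%:R.
  rewrite edges_between_deg mulr_natr -sumr_const; apply: ltr_sum.
    by have /card_gt0P[v vB] := B0; apply/hasP; exists v; rewrite ?mem_index_enum.
  by move=> v; rewrite inE => /andP[].
rewrite -densityE ltNge => /negP; apply.
have -> : d * #|Y|%:R * #|B|%:R = d * (#|B|%:R * #|Y|%:R) by ring.
by apply: ler_wpM2r; [apply: mulr_ge0|lra].
Qed.

End LowDegree.

Lemma natr_subn_ge (R : numDomainType) (a b : nat) :
  a%:R - b%:R <= (a - b)%:R :> R.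
Proof. by rewrite lerBlDr -natrD ler_nat; lia. Qed.

Section ClusterHost.
Variables (R : archiRealFieldType) (G : finType) (e : rel G).
Variables (T : finType) (V : T -> {set G}) (s : nat) (eps delta : R) (E : rel T).
Notation dens i j := (density R e (V i) (V j)).
Hypotheses (e_sym : symmetric e) (E_sym : symmetric E).
Hypothesis cardV : forall i, #|V i| = s.
Hypothesis disjV : forall i j, i != j -> [disjoint V i & V j].
Hypothesis E_reg : forall i j, E i j -> regular_pair e eps (V i) (V j).
Hypothesis E_dens : forall i j, E i j -> delta <= dens i j.

Variables (D : {set T}) (m : T -> T) (cl : bool -> T) (kk : R).
Hypothesis m_inj : {in D &, injective m}.
Hypothesis m_edge : forall v, v \in D -> E v (m v).
Hypothesis cl_edge : E (cl false) (cl true).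
Hypothesis cl_deg : forall b, 2 * kk <=
  wdeg E (fun i j => dens i j) (fun v => (half_cover D m v)%:R) (cl b).

Variables (N : nat) (par : nat -> nat) (W : pred nat) (beta c : nat).
Hypotheses (parP : parent_array N par) (W0 : W 0) (N0 : (0 < N)%N).
Notation top := (top par W).
Notation near := (near par W).
Notation col := (depth_parity par).
Hypothesis small_comp : forall r, (r < N)%N -> ~~ W r ->
  (#|[set i : 'I_N | top i == r]| <= beta)%N.
Hypothesis seed_parity : forall w, (0 < w < N)%N -> W w -> ~~ W (par w) ->
  col w = col (near (par w)).
Hypothesis seeds_card : (#|[set i : 'I_N | W i]| <= c)%N.

Variables (p : bool -> nat) (a1 g : nat) (omega bd : R).
Notation sR := (s%:R : R).
Notation tR := (#|T|%:R : R).
Hypotheses (eps0 : 0 < eps) (eps_delta : eps < delta) (omega0 : 0 < omega).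
Hypothesis (a1_ge : eps * sR <= a1%:R).
Hypothesis (room : 2 * (p false + p true)%:R + 2 * a1%:R + 2 * eps * sR <= sR).
Hypothesis (p_ge : forall b, eps * sR <= (p b)%:R).
Hypothesis (g_gt : eps * sR < g%:R).
Hypothesis (deg_g : eps * sR + beta%:R <= (delta - eps) * g%:R).
Hypothesis (bd_ge : 2 * eps * sR <= omega * bd).
Hypothesis (seed_room : c%:R + eps * sR + bd <= (delta - eps) * a1%:R).
Hypothesis capacity : forall b,
  #|[set i : 'I_N | ~~ W i && (col (near i) == b)]|%:R + 2 * tR * (eps * sR + 1) +
  2 * omega * tR * (p b)%:R + tR * (3 * g%:R + beta%:R) <= 2 * kk * (p b)%:R.

Lemma c_gt0 : (0 < c)%N.
Proof.
apply: leq_trans seeds_card; apply/card_gt0P; exists (Ordinal N0).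
by rewrite inE.
Qed.

Lemma cl_edge_b b : E (cl b) (cl (~~ b)).
Proof. by case: b; rewrite //= E_sym. Qed.

Lemma in_V i j v : v \in V i -> v \in V j -> i = j.
Proof.
move=> vi vj; apply/eqP; apply: contraTT vj => /disjV /disjointFr H.
by rewrite (H _ vi).
Qed.

Lemma dens_le1 i j : dens i j <= 1.
Proof. exact: density_le1. Qed.

Lemma low_degree_le i j (Y : {set G}) : E i j -> Y \subset V j ->
  eps * sR <= #|Y|%:R ->
  #|[set v in V i | #|[set w in Y | e v w]|%:R < (dens i j - eps) * #|Y|%:R]|%:R
    <= eps * sR.
Proof.
move=> eij YV hY; rewrite -(cardV i); apply: few_low_degree (E_reg eij) YV _ _ _ => //.
  by rewrite cardV.
exact: ltW.
Qed.

Lemma low_degree_delta i j (Y : {set G}) : E i j -> Y \subset V j ->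
  eps * sR <= #|Y|%:R ->
  #|[set v in V i | #|[set w in Y | e v w]|%:R < (delta - eps) * #|Y|%:R]|%:R
    <= eps * sR.
Proof.
move=> eij YV hY; apply: le_trans (low_degree_le eij YV hY); rewrite ler_nat.
apply: subset_leq_card; apply/subsetP => v; rewrite !inE => /andP[-> lt] /=.
by apply: lt_le_trans lt _; apply: ler_wpM2r => //; rewrite lerD2r E_dens.
Qed.

Lemma cluster_host_aux (Z1 : bool -> {set G}) (Q : T -> bool -> bool -> {set G}) :
  (forall b, Z1 b \subset V (cl b)) -> (forall b, #|Z1 b| = a1) ->
  (forall v b o, #|Q v b o| = p b) ->
  (forall v b o b' o' x, x \in Q v b o -> x \in Q v b' o' -> b = b' /\ o = o') ->
  (forall v b o, Q v b o \subset V v) ->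
  (forall v b o b' x, x \in Q v b o -> x \notin Z1 b') ->
  (forall v b o x, x \in Q v b o -> E (cl b) v ->
     (delta - eps) * a1%:R <= #|[set w in Z1 b | e x w]|%:R) ->
  exists f : nat -> G,
    {in gtn N &, injective f} /\ forall i, (0 < i < N)%N -> e (f i) (f (par i)).
Proof.
move=> Z1V cZ1 cQ disjQ QV QZ1 QZ1deg.
pose J := {v : T | v \in D}.
(* The cluster carrying side [o] of pair [i]: a first half of [val i] or a second half of its
   partner. A cluster may thus belong to two pairs. *)
pose h (i : J) (o : bool) : T := if o then m (val i) else val i.
have h_inj i i' o o' : o = o' -> h i o = h i' o' -> i = i'.
  move=> <-; rewrite /h; case: o => E1; apply: val_inj => //.
  by apply: m_inj E1; apply: valP.
have h_edge i o : E (h i o) (h i (~~ o)).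
  by case: o; rewrite /h /=; [rewrite E_sym|]; apply: m_edge (valP i).
pose P b (i : J) o := Q (h i o) b o.
(* The neighbours expected from a typical seed, with the density lowered by [eps], rounded down; 0
   if the cluster is no neighbour of [cl b], which forbids roots there. *)
pose x b (i : J) o : nat :=
  if E (cl b) (h i o) then Num.truncn ((dens (cl b) (h i o) - eps) * (p b)%:R) else 0%N.
have x_real b i o : E (cl b) (h i o) ->
    (x b i o)%:R <= (dens (cl b) (h i o) - eps) * (p b)%:R < (x b i o)%:R + 1.
  move=> eb; rewrite /x eb natr1 truncnS_gt andbT truncn_le.
  by apply: mulr_ge0 => //; rewrite subr_ge0; apply: le_trans (E_dens eb); apply: ltW.
have eps_s0 : 0 <= eps * sR by apply: mulr_ge0 => //; exact: ltW.
have bd0 : 0 <= bd.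
  rewrite -(pmulr_rge0 _ omega0); apply: le_trans bd_ge.
  by rewrite -mulrA mulr_ge0.
pose lowZ b := [set v in V (cl b) | #|[set w in Z1 (~~ b) | e v w]|%:R < (delta - eps) * a1%:R].
have lowZ_le b : #|lowZ b|%:R <= eps * sR.
  have := @low_degree_delta (cl b) (cl (~~ b)) (Z1 (~~ b)) (cl_edge_b b) (Z1V _).
  by rewrite cZ1 => /(_ a1_ge).
pose missed b a (io : J * bool) := (#|[set w in P b io.1 io.2 | e a w]| < x b io.1 io.2)%N.
have missed_le b io : #|[set a in V (cl b) | missed b a io]|%:R <= eps * sR.
  case: io => i o; rewrite /missed /=.
  have [eb|neb] := boolP (E (cl b) (h i o)); last first.
    rewrite /x (negPf neb) eq_card0 // => a.
    by rewrite !inE ltn0 andbF.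
  have := @low_degree_le (cl b) (h i o) (P b i o) eb (QV _ _ _).
  rewrite /P cQ => /(_ (p_ge b)); apply: le_trans; rewrite ler_nat.
  apply: subset_leq_card; apply/subsetP => a; rewrite !inE => /andP[-> lt] /=.
  have /andP[lo _] := x_real b i o eb; apply: lt_le_trans lo.
  by rewrite ltr_nat.
pose nmissed b a := #|[set io | missed b a io]|.
(* By double counting, at most [2 * eps * s / omega], hence at most [bd], vertices miss more than
   [omega * tR] halves. *)
pose atyp b := [set a in V (cl b) | omega * tR < (nmissed b a)%:R].
have atyp_le b : #|atyp b|%:R <= bd.
  have t0 : 0 < tR by rewrite ltr0n; apply/card_gt0P; exists (cl b).
  rewrite -(ler_pM2l (mulr_gt0 omega0 t0)).
  apply: (@le_trans _ _ (\sum_(a in V (cl b)) (nmissed b a)%:R)).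
    rewrite mulr_natr -sumr_const big_mkcond [leRHS]big_mkcond /=.
    apply: ler_sum => a _; rewrite inE; case: (a \in V (cl b)) => //=.
    by case: ifP => // /ltW.
  have -> : \sum_(a in V (cl b)) (nmissed b a)%:R =
      \sum_(io : J * bool) #|[set a in V (cl b) | missed b a io]|%:R :> R.
    under eq_bigr => a _ do rewrite /nmissed -sum1_card natr_sum big_mkcond /=.
    rewrite exchange_big /=; apply: eq_bigr => io _.
    rewrite -sum1_card natr_sum [LHS]big_mkcond [RHS]big_mkcond /=.
    by apply: eq_bigr => a _; rewrite !inE; case: (a \in V _).
  apply: (@le_trans _ _ (2 * tR * (eps * sR))).
    apply: (@le_trans _ _ (\sum_(io : J * bool) eps * sR)); first exact: ler_sum.
    rewrite sumr_const -[leLHS]mulr_natl; apply: ler_wpM2r => //.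
    rewrite -natrM ler_nat card_prod card_bool mulnC leq_mul2l /=.
    by rewrite card_sig max_card.
  have := bd_ge; rewrite -(ler_pM2l t0); lra.
pose Z b := Z1 b :\: (lowZ b :|: atyp b).
have ZV b : Z b \subset V (cl b) by apply: subset_trans (Z1V b); apply: subsetDl.
have into_Z b (A : {set G}) : A \subset Z1 b ->
    (delta - eps) * a1%:R <= #|A|%:R -> (c <= #|A :&: Z b|)%N.
  move=> AZ hA; rewrite -(ler_nat R).
  have : #|A|%:R <= #|A :&: Z b|%:R + #|lowZ b|%:R + #|atyp b|%:R :> R.
    rewrite -!natrD ler_nat -(cardsID (Z b)) -addnA leq_add2l.
    have [le _] := leq_card_setU (lowZ b) (atyp b); apply: leq_trans le.
    apply: subset_leq_card; apply/subsetP => v; rewrite !inE negb_and negbK.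
    by move=> /andP[+ vA]; rewrite (subsetP AZ v vA) orbF.
  by have := lowZ_le b; have := atyp_le b; have := seed_room; lra.
have nbr_Z b v : (delta - eps) * a1%:R <= #|[set w in Z1 b | e v w]|%:R ->
    (c <= #|[set w in Z b | e v w]|)%N.
  move=> hv; have := into_Z b [set w in Z1 b | e v w].
  have -> : [set w in Z1 b | e v w] :&: Z b = [set w in Z b | e v w].
    by apply/setP => w; rewrite !inE; case: (w \in Z1 b); case: (e v w); rewrite ?andbF ?andbT.
  by apply=> //; apply/subsetP => w; rewrite inE => /andP[].
have eE : eps * sR < (Num.truncn (eps * sR)).+1%:R by apply: truncnS_gt.
have eE' : (Num.truncn (eps * sR))%:R <= eps * sR by rewrite truncn_le.
apply: (host_embedding e_sym parP W0 small_comp seed_parity (Z := Z) (P := P)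
  (p := p) (x := x) (c := c) (g := g) (h := Num.truncn (eps * sR) + beta)
  (e0 := Num.truncn (eps * sR))) => //.
- by move=> b i o; rewrite /P cQ.
- move=> b i o; rewrite /x; case: ifP => // eb.
  rewrite -(ler_nat R); have /andP[lo _] := x_real b i o eb.
  rewrite /x eb in lo; apply: le_trans lo _; rewrite -[leRHS]mul1r.
  by apply: ler_wpM2r => //; have := dens_le1 (cl b) (h i o); have := eps0; lra.
- move=> b i o b' i' o' v v1 v2.
  have Eh : h i o = h i' o' by apply: in_V (subsetP (QV _ _ _) _ v1) (subsetP (QV _ _ _) _ v2).
  have [Eb Eo] : b = b' /\ o = o' by apply: disjQ v1 _; rewrite Eh.
  by split=> //; apply: h_inj Eh.
- by move=> b b' i o v; rewrite inE => /andP[_]; apply: contraL; apply: QZ1.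
- have := into_Z false (Z1 false) (subxx _); rewrite cZ1 => H.
  apply: leq_trans c_gt0 _; apply: leq_trans (H _) _.
    rewrite -[leRHS]mul1r; apply: ler_wpM2r => //.
    by have := E_dens cl_edge; have := dens_le1 (cl false) (cl true); have := eps0; lra.
  by apply: subset_leq_card; apply: subsetIr.
- move=> b v /setDP[vZ]; rewrite in_setU negb_or => /andP[nl _]; apply: nbr_Z.
  by rewrite leNgt; apply: contra nl => lt; rewrite inE (subsetP (Z1V b)) ?lt.
- move=> b i o v x0 vP; apply: nbr_Z; apply: QZ1deg vP _.
  by move: x0; rewrite /x; case: ifP.
- move=> b i o Y YP hY; rewrite -ltnS -(ltr_nat R); apply: le_lt_trans eE.
  have gY : g%:R <= #|Y|%:R :> R by rewrite ler_nat.
  have YV : Y \subset V (h i (~~ o)) by apply: subset_trans YP (QV _ _ _).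
  apply: le_trans (low_degree_delta (h_edge i o) YV _); last first.
    by apply: le_trans gY; apply: ltW.
  rewrite ler_nat; apply: subset_leq_card; apply/subsetP => v.
  rewrite !inE => /andP[vP lt]; rewrite (subsetP (QV _ _ _) _ vP) /=.
  apply: (@lt_le_trans _ _ (Num.truncn (eps * sR) + beta)%:R); first by rewrite ltr_nat.
  rewrite natrD; have := deg_g.
  have : (delta - eps) * g%:R <= (delta - eps) * #|Y|%:R.
    by apply: ler_wpM2l => //; rewrite subr_ge0 ltW.
  lra.
- by rewrite -(ltr_nat R); apply: le_lt_trans g_gt.
move=> b a aZ; have aV := subsetP (ZV b) a aZ.
have na : (nmissed b a)%:R <= omega * tR.
  move: aZ; rewrite in_setD in_setU negb_or => /andP[/andP[_ nat_a] _].
  by rewrite leNgt; apply: contra nat_a => lt; rewrite inE aV.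
have pS : (p b)%:R <= sR.
  have : 0 <= (p (~~ b))%:R :> R by []. 
  by have := room; have := ler0n R a1; have := ler0n R s; move: eps_s0;
    rewrite natrD; case: (b) => /=; lra.
pose sl := 3 * g%:R + beta%:R : R.
pose term (i : J) : R := \sum_o
  (if E (cl b) (h i o) then dens (cl b) (h i o) else 0).
have termE : \sum_i term i = wdeg E (fun i j => dens i j)
    (fun v => (half_cover D m v)%:R) (cl b).
  rewrite /term; under eq_bigr => i _ do rewrite big_bool.
  rewrite big_split /=.
  rewrite -(big_sub (mem D) (fun v => if E (cl b) (m v) then dens (cl b) (m v) else 0)).
  rewrite -(big_sub (mem D) (fun v => if E (cl b) v then dens (cl b) v else 0)).
  rewrite -(big_imset (fun v => if E (cl b) v then dens (cl b) v else 0)) //=.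
  rewrite /wdeg big_mkcond [X in _ + X]big_mkcond [RHS]big_mkcond -big_split /=.
  apply: eq_bigr => v _; rewrite /half_cover natrD mulrDr.
  by case: (E (cl b) v); case: (v \in D); case: (v \in m @: D); rewrite /= ?mulr1n ?mulr0n ?mulr1 ?mulr0 ?addr0 ?add0r.
pose miss i : R := (missed b a (i, false))%:R + (missed b a (i, true))%:R.
have missE : \sum_i miss i = (nmissed b a)%:R.
  rewrite /nmissed -sum1_card natr_sum.
  transitivity (\sum_i \sum_o (missed b a (i, o))%:R : R).
    by apply: eq_bigr => i _; rewrite big_bool /= addrC.
  rewrite pair_big [RHS]big_mkcond /=; apply: eq_bigr => -[i o] _.
  by rewrite inE; case: ifP.
have x_ge i o : (if E (cl b) (h i o) then dens (cl b) (h i o) else 0) * (p b)%:R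
    - (eps * sR + 1) <= (x b i o)%:R.
  have epS : eps * (p b)%:R <= eps * sR by rewrite ler_pM2l.
  case: ifP => [eb|_]; last by have := ler0n R (x b i o); lra.
  by have /andP[_] := x_real b i o eb; lra.
have x_lep i o : (x b i o)%:R <= (p b)%:R :> R.
  rewrite /x; case: ifP => // eb; have /andP[+ _] := x_real b i o eb.
  rewrite /x eb => /le_trans; apply; rewrite -[leRHS]mul1r.
  by apply: ler_wpM2r => //; have := dens_le1 (cl b) (h i o); have := eps0; lra.
(* Rounding and slack are subtracted for every pair. If the pair is not typical then [miss i >= 1],
   and the last term makes the left side nonpositive, as the two sides offer at most [2 * p b]. *)
have each i : term i * (p b)%:R - 2 * (eps * sR + 1) - sl - 2 * (p b)%:R * miss i <=
    if typical e P x b a i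
    then (x b i false + x b i true - (3 * g + beta))%:R else 0 :> R.
  have := x_ge i false; have := x_ge i true; rewrite /term big_bool mulrDl.
  have := x_lep i false; have := x_lep i true.
  have m0 : 0 <= miss i by rewrite addr_ge0.
  have pm : 0 <= 2 * (p b)%:R * miss i by rewrite !mulr_ge0.
  have sl0 : 0 <= sl by rewrite addr_ge0 ?mulr_ge0.
  case: (boolP (typical e P x b a i)) => [_|]; last first.
    rewrite /typical negb_forall => /existsP[o]; rewrite -ltnNge => mo.
    have {}mo : missed b a (i, o) := mo.
    have : 1 <= miss i by rewrite /miss; case: o mo => ->; rewrite ?lerDl ?lerDr.
    move=> m1; have : 2 * (p b)%:R * 1 <= 2 * (p b)%:R * miss i.
      by apply: ler_wpM2l => //; rewrite mulr_ge0.
    by move: eps_s0; lra.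
  have : (x b i false + x b i true)%:R - sl <=
      (x b i false + x b i true - (3 * g + beta))%:R :> R.
    by rewrite (_ : sl = (3 * g + beta)%:R) ?natr_subn_ge // natrD natrM.
  by rewrite natrD; lra.
rewrite -(ler_nat R) natr_sum [leRHS]big_mkcond /=.
apply: le_trans (ler_sum _ (fun i _ => each i)).
have sE : \sum_i 2 * (p b)%:R * miss i = 2 * (p b)%:R * (nmissed b a)%:R.
  by rewrite -mulr_sumr missE.
rewrite !sumrB -mulr_suml termE sE !sumr_const.
have cJ : #|{: J}|%:R <= tR by rewrite ler_nat card_sig max_card.
have h1 := capacity b; have h2 := cl_deg b.
have h3 : 2 * kk * (p b)%:R <= wdeg E (fun i j => dens i j)
   (fun v => (half_cover D m v)%:R) (cl b) * (p b)%:R by apply: ler_wpM2r.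
have h4 : 2 * (p b)%:R * (nmissed b a)%:R <= 2 * (p b)%:R * (omega * tR).
  by apply: ler_wpM2l => //; rewrite mulr_ge0.
have h5 : (2 * (eps * sR + 1)) *+ #|{: J}| <= 2 * tR * (eps * sR + 1).
  rewrite -[leLHS]mulr_natr mulrAC; apply: ler_wpM2r; first lra.
  by apply: ler_wpM2l.
have h6 : sl *+ #|{: J}| <= tR * sl.
  by rewrite -[leLHS]mulr_natl; apply: ler_wpM2r; rewrite // addr_ge0 ?mulr_ge0.
have h7 : 2 * omega * tR * (p b)%:R = 2 * (p b)%:R * (omega * tR) by ring.
rewrite /sl in h6 *.
move: h1; rewrite h7; move: h3 h4 h5 h6.
lra.
Qed.

Lemma cluster_host : exists f : nat -> G,
    {in gtn N &, injective f} /\ forall i, (0 < i < N)%N -> e (f i) (f (par i)).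
Proof.
have eps_s0 : 0 <= eps * sR by apply: mulr_ge0 => //; exact: ltW.
have a1s : (a1 <= s)%N.
  rewrite -(ler_nat R); have := room; have := ler0n R (p false + p true).
  by have := ler0n R a1; have := ler0n R s; move: eps_s0; lra.
have [Z1 Z1V cZ1] : exists2 Z1 : bool -> {set G},
    forall b, Z1 b \subset V (cl b) & forall b, #|Z1 b| = a1.
  apply: (@fin_all_exists2 bool (fun=> {set G}) (fun b Z => Z \subset V (cl b)) (fun b Z => #|Z| = a1)) => b.
  by apply: subset_of_card; rewrite cardV.
pose low b v := if E (cl b) v then
  [set x in V v | #|[set w in Z1 b | e x w]|%:R < (delta - eps) * a1%:R] else set0.
have low_le b v : #|low b v|%:R <= eps * sR.
  rewrite /low; case: ifP => [eb|_]; last by rewrite cards0.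
  rewrite E_sym in eb; have := low_degree_delta eb (Z1V b).
  by rewrite cZ1; apply.
(* A cluster may lose two seed sets and, for each parity, its vertices with few neighbours in the
   seed set. Four pieces are then cut from the rest, one for each parity and each half; [room] adds
   this up. *)
pose U v := V v :\: (Z1 false :|: Z1 true :|: (low false v :|: low true v)).
have cU v : (\sum_(bo : bool * bool) p bo.1 <= #|U v|)%N.
  rewrite -(pair_bigA _ (fun b _ => p b)) /= big_bool !big_bool /= -(ler_nat R).
  have : #|V v|%:R <= #|U v|%:R + (a1%:R + a1%:R + (#|low false v|%:R + #|low true v|%:R)) :> R.
    rewrite -!natrD ler_nat -(cardsID (Z1 false :|: Z1 true :|: (low false v :|: low true v)) (V v)) addnC.
    rewrite leq_add2l; apply: leq_trans (subset_leq_card (subsetIr _ _)) _.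
    have le (A B : {set G}) : (#|A :|: B| <= #|A| + #|B|)%N by have [] := @leq_card_setU G A B.
    apply: leq_trans (le _ _) _; rewrite leq_add ?le //.
    by have := le (Z1 false) (Z1 true); rewrite !cZ1.
  have := low_le false v; have := low_le true v; have := room.
  by rewrite cardV !natrD; lra.
have [Q HQ] : exists Q : T -> bool * bool -> {set G}, forall v,
    [/\ forall i, #|Q v i| = p i.1, forall i, Q v i \subset U v
    & forall i j x, x \in Q v i -> x \in Q v j -> i = j].
  apply: (@fin_all_exists T (fun=> bool * bool -> {set G})
    (fun v Qv => [/\ forall i, #|Qv i| = p i.1, forall i, Qv i \subset U v
    & forall i j x, x \in Qv i -> x \in Qv j -> i = j])) => v.
  exact: disjoint_pieces (cU v).
have QU v b o x : x \in Q v (b, o) -> x \in U v by have [_ /(_ (b, o)) /subsetP H _] := HQ v; apply: H.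
apply: (@cluster_host_aux Z1 (fun v b o => Q v (b, o))) => //.
- by move=> v b o; have [-> _ _] := HQ v.
- by move=> v b o b' o' x x1 x2; have [_ _ /(_ _ _ _ x1 x2)] := HQ v; case.
- by move=> v b o; apply/subsetP => x /QU; rewrite in_setD => /andP[].
- move=> v b o b' x /QU; rewrite in_setD !in_setU !negb_or => /andP[/andP[/andP[n1 n2] _] _].
  by case: b'.
- move=> v b o x /QU; rewrite in_setD !in_setU !negb_or => /andP[/andP[_ /andP[n1 n2]] xV] eb.
  have : x \notin low b v by case: (b).
  by rewrite /low eb inE xV /= -leNgt.
Qed.

End ClusterHost.

Lemma wdeg_le (R : realFieldType) (T : finType) (E : rel T) (w : T -> T -> R)
    (f : T -> R) (M : R) u :
  (forall v, 0 <= w u v <= 1) -> (forall v, 0 <= f v <= M) ->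
  wdeg E w f u <= M * #|T|%:R.
Proof.
move=> w01 fM; rewrite mulr_natr -sumr_const /wdeg big_mkcond /=.
apply: ler_sum => v _; have /andP[w0 w1] := w01 v; have /andP[f0 fm] := fM v.
case: ifP => _; last exact: le_trans f0 fm.
by apply: le_trans fm; rewrite -[leRHS]mul1r; apply: ler_wpM2r.
Qed.

Lemma truncn_bounds (R : archiRealFieldType) (y : R) : 0 <= y ->
  (Num.truncn y)%:R <= y /\ y - 1 <= (Num.truncn y)%:R.
Proof.
by move=> y0; rewrite truncn_le y0; split=> //; rewrite lerBlDr natr1 ltW ?truncnS_gt.
Qed.

(** With this value the bound [256 * eps * s / zeta] on atypical seeds equals
    [delta * zeta * s / 512], half of the guaranteed degree into a seed set. *)
Definition regularity_constant (R : realFieldType) (zeta delta : R) : R :=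
  delta * zeta ^+ 2 / (512 * 256).

Lemma regularity_constant_gt0 (R : realFieldType) (zeta delta : R) :
  0 < zeta -> 0 < delta -> 0 < regularity_constant zeta delta.
Proof. by move=> z0 d0; rewrite divr_gt0 ?mulr_gt0 // exprn_gt0. Qed.

Lemma cluster_embedding (R : archiRealFieldType) (zeta delta : R) (M : nat) :
  0 < zeta -> zeta <= 1 -> 0 < delta -> delta <= 1 -> exists s0 : nat,
  forall (G : finType) (e : rel G) (T : finType) (V : T -> {set G}) (s : nat)
    (E : rel T) (kk : R) (N : nat) (par : nat -> nat),
  symmetric e -> (#|T| <= M)%N -> (s0 <= s)%N -> (forall i, #|V i| = s) ->
  (forall i j, i != j -> [disjoint V i & V j]) ->
  symmetric E ->
  (forall i j, E i j -> regular_pair e (regularity_constant zeta delta) (V i) (V j)) ->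
  (forall i j, E i j -> delta <= density R e (V i) (V j)) ->
  seeded_matching E (fun i j => density R e (V i) (V j)) kk ->
  0 < kk -> (0 < N)%N -> parent_array N par ->
  N%:R + zeta / 2 * (#|T|%:R * s%:R) <= kk * s%:R ->
  exists f : nat -> G,
    {in gtn N &, injective f} /\ forall i, (0 < i < N)%N -> e (f i) (f (par i)).
Proof.
move=> zeta0 zeta1 delta0 delta1; set eps := regularity_constant zeta delta.
have dz0 : 0 < delta * zeta by apply: mulr_gt0.
have z16 : 0 <= 1 - zeta / 16 by move: zeta1; clear; lra.
(* A bound on [N / beta] independent of [s]: the tree has at most [M * s] vertices, and [beta] is at
   least [delta * zeta * s / 2048]. *)
pose K := (Num.truncn (2048 * M%:R / (delta * zeta))).+1.
have hK : 2048 * M%:R <= K%:R * (delta * zeta).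
  by rewrite -ler_pdivrMr //; apply: ltW; apply: truncnS_gt.
pose c := K.+1.*2.
exists (Num.truncn ((2048 + 1024 * c%:R) / (delta * zeta))).+1.
move=> G e T V s E kk N par e_sym TM hs cardV disjV E_sym E_reg E_dens.
move=> [D [m [A [B [mi mE eAB dAB]]]]] kk0 N0 parP hN.
set S := s%:R : R; set t := #|T|%:R : R.
have big : 2048 + 1024 * c%:R <= delta * zeta * S.
  rewrite [leRHS]mulrC -ler_pdivrMr //; apply: ltW; apply: lt_le_trans (truncnS_gt _) _.
  by rewrite ler_nat.
have c0 : 0 <= c%:R :> R by [].
have S0 : 0 < S.
  by rewrite -(pmulr_rgt0 _ dz0); move: big c0; clear; lra.
have t0 : 0 < t by rewrite ltr0n; apply/card_gt0P; exists A.
have dz_z : delta * zeta * S <= zeta * S.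
  by apply: ler_wpM2r; [exact: ltW|rewrite -[leRHS]mul1r; apply: ler_wpM2r => //; exact: ltW].
have zS : zeta * S <= S by rewrite -[leRHS]mul1r; apply: ler_wpM2r => //; exact: ltW.
have epsS : eps * S = zeta * (delta * zeta * S) / (512 * 256).
  by rewrite /eps /regularity_constant; field.
have epsS_le : eps * S <= delta * zeta * S / (512 * 256).
  have : zeta * (delta * zeta * S) <= 1 * (delta * zeta * S) by apply: ler_wpM2r; rewrite // ltW // mulr_gt0.
  by rewrite epsS; clear; lra.
have eps0 : 0 < eps by apply: regularity_constant_gt0.
have epsS0 : 0 < eps * S by apply: mulr_gt0.
have eps_delta : eps < delta / 2.
  have : zeta ^+ 2 <= 1 by apply: exprn_ile1 => //; exact: ltW.
  rewrite /eps /regularity_constant => z2; have : delta * zeta ^+ 2 <= delta * 1 by rewrite ler_pM2l.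
  by move: delta0; clear; lra.
have kkt : kk <= t.
  have H := dAB A (mem_head _ _).
  suff : wdeg E (fun i j => density R e (V i) (V j)) (fun v => (half_cover D m v)%:R) A <= 2 * t.
    by move: H; clear; lra.
  apply: wdeg_le => v; first by rewrite density_ge0 density_le1.
  exact: half_cover_le2.
have ts0 : 0 < t * S by apply: mulr_gt0.
have NtS : N%:R <= t * S.
  have : kk * S <= t * S by rewrite ler_pM2r.
  have : 0 < zeta / 2 * (t * S) by rewrite mulr_gt0 // divr_gt0.
  by move: hN; rewrite -/S -/t; clear; lra.
pose beta := Num.truncn (delta * zeta * S / 1024).
have [b1 b2] : beta%:R <= delta * zeta * S / 1024 /\ delta * zeta * S / 1024 - 1 <= beta%:R.
  by apply: truncn_bounds; move: big c0; clear; lra.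
have beta0 : (0 < beta)%N by rewrite -(ltr0n R); move: b2 big c0; clear; lra.
have [W [W0 Wc Wcomp Wpar]] := seeds_exist parP beta0 N0.
have seeds_c : (#|[set i : 'I_N | W i]| <= c)%N.
  apply: leq_trans Wc _; rewrite leq_double ltnS -(leq_pmul2r beta0).
  apply: leq_trans (leq_trunc_div _ _) _; rewrite -(ler_nat R) natrM.
  apply: le_trans NtS _; have : t <= M%:R by rewrite ler_nat.
  have : K%:R * (delta * zeta * S / 2048) <= K%:R * beta%:R.
    by apply: ler_wpM2l => //; move: b2 big c0; clear; lra.
  have : 2048 * M%:R * S <= K%:R * (delta * zeta) * S by rewrite ler_pM2r.
  move=> h1 h2 h3; have : t * S <= M%:R * S by rewrite ler_pM2r.
  by move: h1 h2; clear; lra.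
pose F b := #|[set i : 'I_N | ~~ W i && (depth_parity par (near par W i) == b)]|.
have FN : (F false + F true <= N)%N.
  rewrite -[leqRHS]card_ord addnC /F.
  rewrite -(cardsC [set i : 'I_N | ~~ W i && (depth_parity par (near par W i) == true)]).
  rewrite leq_add2l; apply: subset_leq_card; apply/subsetP => i.
  by rewrite !inE => /andP[-> /eqP ->].
pose g := Num.truncn (zeta * S / 64).
have [g1 g2] : g%:R <= zeta * S / 64 /\ zeta * S / 64 - 1 <= g%:R.
  by apply: truncn_bounds; move: dz_z big c0; clear; lra.
(* Every half-cluster is split between the two parities in proportion to the
   number [F b] of vertices that hang below seeds of parity [b]. *)
pose q b := ((F b)%:R + zeta / 4 * (t * S)) / (2 * kk).
have q0 b : 0 <= q b.
  apply: divr_ge0; last by apply: mulr_ge0 => //; apply: ltW.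
  by apply: addr_ge0 => //; apply: mulr_ge0; [apply: divr_ge0 => //|]; apply: ltW.
(* The factor [1 - zeta / 16] frees room for the seed sets and the low-degree vertices. *)
pose p b := Num.truncn (q b * (1 - zeta / 16)).
have pb b : (p b)%:R <= q b * (1 - zeta / 16) /\ q b * (1 - zeta / 16) - 1 <= (p b)%:R.
  by apply: truncn_bounds; apply: mulr_ge0.
have q_kk b : 2 * kk * q b = (F b)%:R + zeta / 4 * (t * S).
  by rewrite /q mulrC divfK // mulf_neq0 // ?gt_eqF.
have FNR : (F false)%:R + (F true)%:R <= N%:R :> R by rewrite -natrD ler_nat.
have q_sum : 2 * (q false + q true) <= S.
  rewrite -(ler_pM2l kk0); have := q_kk false; have := q_kk true.
  by move: FNR hN; rewrite -/S -/t; clear; lra.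
(* The reserve [zeta / 4] in [q] keeps the portion of a parity large even if hardly any vertex hangs
   below its seeds. *)
have q_S b : zeta * S / 8 <= q b.
  have k20 : 0 < 2 * kk by rewrite mulr_gt0.
  rewrite -(ler_pM2l k20) q_kk.
  have : kk * (zeta * S) <= t * (zeta * S) by rewrite ler_pM2r // mulr_gt0.
  by move: (ler0n R (F b)); clear; lra.
have q_S2 b : q b <= S / 2.
  by move: (q0 (~~ b)) q_sum; case: b => /=; clear; lra.
have z0' : 0 <= zeta / 16 by rewrite divr_ge0 // ltW.
have qz b : 0 <= q b * (zeta / 16) <= zeta * S / 32.
  rewrite mulr_ge0 //=; apply: le_trans (ler_wpM2r z0' (q_S2 b)) _.
  by clear; lra.
have pS b : 2 * (p b)%:R <= S.
  by have [+ _] := pb b; move: (qz b) (q_S2 b); rewrite mulrBr mulr1 => /andP[];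
     clear; lra.
have deg_bound : delta * zeta * S / 256 <= (delta - eps) * g%:R.
  apply: (@le_trans _ _ (delta / 2 * (zeta * S / 128))); first by clear; lra.
  apply: ler_pM.
  - by rewrite divr_ge0 // ltW.
  - by rewrite divr_ge0 // mulr_ge0 // ltW.
  - by move: eps_delta; clear; lra.
  - by move: g2 dz_z big c0; clear; lra.
have bdE : 256 * (eps * S) / zeta = delta * zeta * S / 512.
  by rewrite epsS; field; rewrite gt_eqF.
pose cl b := if b then B else A.
have cl_deg b : 2 * kk <= wdeg E (fun i j => density R e (V i) (V j))
    (fun v => (half_cover D m v)%:R) (cl b).
  by apply: dAB; case: b; rewrite !inE eqxx ?orbT.
have epsd : eps < delta by move: eps_delta delta0; clear; lra.
have om0 : 0 < zeta / 128 by rewrite divr_gt0.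
apply: (cluster_host e_sym E_sym cardV disjV E_reg E_dens
  mi mE (cl := cl) eAB cl_deg parP W0 N0 Wcomp Wpar seeds_c (p := p) (a1 := g)
  (g := g) eps0 epsd om0 (bd := 256 * (eps * S) / zeta)); rewrite -/S -/t.
- by move: epsS_le dz_z big c0 g2; clear; lra.
- have [pf _] := pb false; have [pt _] := pb true.
  have := ler_wpM2r z16 q_sum; move: pf pt epsS_le dz_z g1; rewrite natrD.
  by move: (mulr_gt0 zeta0 S0); clear; lra.
- move=> b; have [_ +] := pb b; have /andP[_ +] := qz b; have := q_S b.
  by move: epsS_le dz_z big c0; rewrite mulrBr mulr1; clear; lra.
- by move: epsS_le dz_z big c0 g2; clear; lra.
- by move: deg_bound epsS_le b1 big c0; clear; lra.
- by rewrite le_eqVlt; apply/orP; left; apply/eqP; field; rewrite gt_eqF.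
- by rewrite bdE; move: deg_bound epsS_le big c0; clear; lra.
- move=> b; have [_ pl] := pb b.
  have : 2 * kk * (q b * (1 - zeta / 16) - 1) <= 2 * kk * (p b)%:R.
    by apply: ler_wpM2l => //; rewrite mulr_ge0 // ltW.
  apply: le_trans; rewrite -/(F b).
  have -> : 2 * kk * (q b * (1 - zeta / 16) - 1) =
      2 * kk * q b * (1 - zeta / 16) - 2 * kk by ring.
  rewrite q_kk.
  have tW := ltW t0; 
  have h1 : t * (eps * S) <= t * (zeta * S / (512 * 256)).
    by apply: ler_wpM2l => //; move: epsS_le dz_z; clear; lra.
  have h2 : zeta * (t * (2 * (p b)%:R)) <= zeta * (t * S).
    by apply: ler_wpM2l; [exact: ltW|exact: ler_wpM2l].
  have h3 : t * (3 * g%:R + beta%:R) <= t * (3 * (zeta * S / 64) + zeta * S / 1024).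
    by apply: ler_wpM2l => //; move: g1 b1 dz_z; clear; lra.
  have h4 : ((F b)%:R + zeta / 4 * (t * S)) * (zeta / 16) <= t * S * (zeta / 16).
    apply: ler_wpM2r => //; rewrite -q_kk.
    have : kk * S <= t * S by rewrite ler_pM2r.
    have : kk * q b <= kk * (S / 2) by rewrite ler_pM2l.
    by clear; lra.
  have h5 : t * 2048 <= t * (zeta * S).
    by apply: ler_wpM2l => //; move: big c0 dz_z; clear; lra.
  have h6 := mulr_gt0 t0 (mulr_gt0 zeta0 S0).
  by move: h1 h2 h3 h4 h5 h6 kkt; clear; lra.
Qed.

(** * Ramsey numbers *)

Lemma nat_least (P : nat -> Prop) n : P n ->
  exists r, [/\ P r, forall j, P j -> (r <= j)%N & (r <= n)%N].
Proof.
elim/ltn_ind: n => n IH Pn.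
have [[j [Pj jn]]|none] := classic (exists j, P j /\ (j < n)%N).
  have [r [Pr rmin rj]] := IH j jn Pj; exists r; split=> //.
  exact: leq_trans rj (ltnW jn).
exists n; split=> // j Pj; rewrite leqNgt; apply/negP => jn.
by apply: none; exists j.
Qed.

Section Complement.
Variables (R : realFieldType) (G : sgraph).

Lemma density_compl (X Y : {set G}) :
  [disjoint X & Y] -> (0 < #|X|)%N -> (0 < #|Y|)%N ->
  density R (@compl_adj G) X Y = 1 - density R (@adj G) X Y.
Proof.
move=> dis X0 Y0; have nz : #|X|%:R * #|Y|%:R != 0 :> R.
  by rewrite mulf_neq0 // pnatr_eq0 -lt0n.
have E : edges_between R (@compl_adj G) X Y + edges_between R (@adj G) X Y =
    #|X|%:R * #|Y|%:R.
  rewrite /edges_between -big_split mulrC mulr_natr -sumr_const /=.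
  apply: eq_bigr => x xX; rewrite -big_split -sumr_const /=.
  apply: eq_bigr => y yY; rewrite /compl_adj.
  have -> : x != y by apply: contraTneq yY => <-; rewrite (disjointFr dis xX).
  by case: (adj x y); rewrite /= ?addr0 ?add0r.
by apply: (mulIf nz); rewrite mulrBl mul1r /density !divfK // -E addrK.
Qed.

Lemma regular_pair_compl (eps : R) (X Y : {set G}) :
  0 < eps -> [disjoint X & Y] -> (0 < #|X|)%N -> (0 < #|Y|)%N ->
  regular_pair (@adj G) eps X Y -> regular_pair (@compl_adj G) eps X Y.
Proof.
move=> e0 dis X0 Y0 /forallP reg; apply/forallP => P; apply/forallP => Q.
apply/implyP => hyp; have /forallP/(_ Q)/implyP/(_ hyp) := reg P.
have /and4P[PX QY hP hQ] := hyp.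
have P0 : (0 < #|P|)%N.
  by rewrite -(ltr0n R); apply: lt_le_trans hP; rewrite mulr_gt0 ?ltr0n.
have Q0 : (0 < #|Q|)%N.
  by rewrite -(ltr0n R); apply: lt_le_trans hQ; rewrite mulr_gt0 ?ltr0n.
have disPQ : [disjoint P & Q] by apply: disjointWl PX (disjointWr QY dis).
rewrite !density_compl //; move: (density _ _ P Q) (density _ _ X Y) => a b.
by rewrite (_ : 1 - a - (1 - b) = - (a - b)) ?normrN //; ring.
Qed.

End Complement.

(** The constant 27: [8 * rho] is [24 * eta] of the clusters, the slack in both [kk] adds [eta], and
    the clusters miss at most [2 * eta] of the vertices. The summand 2 is there because the trees
    have [k + 1] and [m + 1] vertices. *)
Lemma ramsey_property_bound (R : realType) (eta : R) :
  0 < eta -> eta <= 1 / 100 ->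
  exists M : nat, forall (G : sgraph) (k m : nat), (M <= #|G|)%N ->
    (k + m + 2)%:R <= (1 - 27 * eta) * #|G|%:R ->
    (forall H, trees k.+1 H -> subgraph_of H G) \/
    (forall H, trees m.+1 H -> subgraph_of H (compl_graph G)).
Proof.
move=> eta0 eta1; pose eps := regularity_constant eta eta.
have eps0 : 0 < eps by apply: regularity_constant_gt0.
have eps_eta : eps <= eta ^+ 2.
  rewrite /eps /regularity_constant ler_pdivrMr ?mulr_gt0 // mulrC ler_pM2l ?exprn_gt0 //.
  by lra.
have eta4 : eta <= 1 / 4 by lra.
have eta1' : eta <= 1 by lra.
have [M HM] := regular_clusters_degree 1 eta0 eta4 eps0 eps_eta.
have [s0 Hs0] := cluster_embedding M eta0 eta1' eta0 eta1'.
(* The clusters cover at least half of the graph, so this order forces their size above [s0]. *)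
exists (maxn M (2 * M * s0.+1).+1) => G k m; rewrite geq_max => /andP[GM Gs] size.
have [T [s [V [/andP[T0 TM] cardV disjV cover irreg]]]] := HM G (@adj G) GM.
have t0 : 0 < #|T|%:R :> R by rewrite ltr0n.
have G0 : 0 < #|G|%:R :> R by rewrite ltr0n; apply: leq_trans Gs.
have ss0 : (s0 < s)%N.
  rewrite ltnNge; apply/negP => ss.
  have : #|T|%:R * s%:R <= M%:R * s0.+1%:R :> R.
    by rewrite -!natrM ler_nat leq_mul // leqW.
  have : (2 * (M%:R * s0.+1%:R)) < #|G|%:R :> R.
    by rewrite -!natrM ltr_nat mulnA.
  have : 0 <= (1 / 2 - 2 * eta) * #|G|%:R by apply: mulr_ge0; lra.
  lra.
have s_gt0 : 0 < s%:R :> R by rewrite ltr0n (leq_trans _ ss0).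
have V0 i : (0 < #|V i|)%N by rewrite cardV (leq_trans _ ss0).
pose col (c : bool) : rel G := if c then @compl_adj G else @adj G.
have col_sym c : symmetric (col c).
  by case: c; [apply: compl_adj_sym|apply: adj_sym].
pose w c i j := density R (col c) (V i) (V j).
pose reg i j := (i != j) && regular_pair (@adj G) eps (V i) (V j).
(* Tree orders measured in clusters; the extra [eta / 2] is the slack that [cluster_embedding] asks
   for. *)
pose kk (c : bool) : R := (if c then m else k).+1%:R / s%:R + eta / 2 * #|T|%:R.
pose rho : R := 3 * eta * #|T|%:R.
have reg_sym : symmetric reg.
  by move=> i j; rewrite /reg eq_sym regular_pair_sym //; apply: adj_sym.
have w_sym c i j : w c i j = w c j i.
  rewrite /w /density /edges_between exchange_big /= [X in _ / X]mulrC.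
  by congr (_ / _); apply: eq_bigr => x _; apply: eq_bigr => y _; rewrite col_sym.
have w_ge0 c i j : 0 <= w c i j by apply: density_ge0.
have w_compl c i j : reg i j -> w c i j + w (~~ c) i j = 1.
  move=> /andP[ij _]; rewrite /w /col.
  have := density_compl R (disjV i j ij) (V0 i) (V0 j).
  by case: c => /= ->; lra.
have eta_half : eta <= 1 / 2 by lra.
have eta_rho : eta * #|T|%:R <= rho.
  by rewrite /rho -mulrA ler_peMl ?mulr_ge0 ?ltW //; lra.
have kk0 c : 0 < kk c.
  by apply: addr_gt0; [rewrite divr_gt0|rewrite mulr_gt0 // divr_gt0].
have kk_sum : kk false + kk true + 8 * rho <= #|T|%:R.
  rewrite -(ler_pM2r s_gt0) /kk /rho.
  have -> : (k.+1%:R / s%:R + eta / 2 * #|T|%:R + (m.+1%:R / s%:R + eta / 2 * #|T|%:R) +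
      8 * (3 * eta * #|T|%:R)) * s%:R =
      (k + m + 2)%:R + 25 * eta * (#|T|%:R * s%:R).
    rewrite -!natr1 !natrD; field; exact: lt0r_neq0.
  have : (1 - 25 * eta) * ((1 - 2 * eta) * #|G|%:R) <=
      (1 - 25 * eta) * (#|T|%:R * s%:R) by apply: ler_wpM2l => //; lra.
  have : 0 <= eta * eta * #|G|%:R by rewrite !mulr_ge0 // ltW.
  move: size; lra.
have [c good] := reduced_graph reg_sym irreg w_sym w_ge0 w_compl eta0 eta_half
  eta_rho kk0 kk_sum.
have embed (H : sgraph) (par : nat -> nat) : trees (if c then m else k).+1 H ->
    parent_array #|H| par ->
    exists f : nat -> G, {in gtn #|H| &, injective f} /\
      forall i, (0 < i < #|H|)%N -> col c (f i) (f (par i)).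
  move=> [[[H0 _] _] HN] parP.
  apply: (Hs0 G (col c) T V s (edge reg w eta c) (kk c) #|H| par) => //.
  - exact: ltnW.
  - exact: edge_sym.
  - move=> i j /andP[/andP[ij rij] _]; case: (c) => //.
    by apply: regular_pair_compl; rewrite ?V0 // disjV.
  - by move=> i j /andP[].
  - rewrite [#|H|]HN /kk mulrDl divfK ?lt0r_neq0 //.
    by rewrite mulrA.
case: c good embed => _ embed; [right|left] => H tH;
  by apply: subgraph_of_tree => [|par parP]; [case: tH|apply: embed].
Qed.

Theorem corollary3 (R : realType) (eps : R) (heps : 0 < eps) :
  exists n0 : nat, forall k m : nat,
    (0 < k)%N -> (0 < m)%N -> (n0 <= k + m)%N ->
    exists r : nat,
      is_ramsey_number (trees k.+1) (trees m.+1) r /\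
      r%:R <= (1 + eps) * (k + m)%:R.
Proof.
pose e1 : R := Num.min eps 1.
have e1_gt0 : 0 < e1 by rewrite lt_min heps ltr01.
have e1_le1 : e1 <= 1 by rewrite ge_min lexx orbT.
have e1_eps : e1 <= eps by rewrite ge_min lexx.
have eta0 : 0 < e1 / 100 by rewrite divr_gt0.
have eta1 : e1 / 100 <= 1 / 100 by rewrite ler_pM2r ?invr_gt0.
have [M HM] := ramsey_property_bound eta0 eta1.
(* As [e1 <= 1], [(1 + e1) * (1 - 27 * e1 / 100)] is at least [1 + 46 * e1 / 100]. With
   [e1 * K >= 7] the surplus over [K] exceeds 3: two for the additional tree vertices and one for
   rounding. *)
exists (maxn M (Num.truncn (7 / e1)).+1) => k m _ _; rewrite geq_max => /andP[MK bigK].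
set K := (k + m)%N in MK bigK *.
have K7 : 7 <= e1 * K%:R.
  rewrite mulrC -ler_pdivrMr //; apply: ltW; apply: lt_le_trans (truncnS_gt _) _.
  by rewrite ler_nat.
have e1K : 0 <= (1 + e1) * K%:R by rewrite mulr_ge0 // addr_ge0 // ltW.
pose n := Num.truncn ((1 + e1) * K%:R).
have Kn : (K <= n)%N.
  rewrite truncn_ge_nat // -[leLHS]mul1r; apply: ler_wpM2r => //.
  by rewrite lerDl ltW.
have prop : ramsey_property (trees k.+1) (trees m.+1) n.
  move=> G nG; apply: HM; first exact: leq_trans MK (leq_trans Kn nG).
  have : (1 + e1) * K%:R - 1 <= #|G|%:R.
    rewrite lerBlDr natr1; apply: le_trans (ltW (truncnS_gt _)) _.
    by rewrite ler_nat ltnS.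
  move=> /(ler_wpM2l (_ : 0 <= 1 - 27 * (e1 / 100))) H.
  apply: le_trans (H _); last by lra.
  rewrite -/K natrD.
  have : e1 * (e1 * K%:R) <= 1 * (e1 * K%:R).
    by apply: ler_wpM2r => //; rewrite mulr_ge0 // ltW.
  lra.
have [r [rprop rmin rn]] := nat_least prop.
exists r; split; first by split.
apply: (@le_trans _ _ n%:R); first by rewrite ler_nat.
apply: (@le_trans _ _ ((1 + e1) * K%:R)); first by rewrite truncn_le.
by apply: ler_wpM2r => //; rewrite lerD2l.
Qed.
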